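(* Let $K$ be a field of characteristic different from $2$ and let $X$ be a connected poset such that every multiplicative automorphism of $FI(X,K)$ is inner and every derivation from $FI(X,K)$ to $I(X,K)$ is inner. Let $\lambda$ be an involution on $X$ with at least one fixed point in $X$, and let $X_3=\{x\in X:\lambda(x)=x\}$. Let $\Phi_1$ and $\Phi_2$ be involutions on $D(X,K)$ that induce $\lambda$ on $X$. Then $\Phi_1$ and $\Phi_2$ are equivalent via inner automorphism if and only if they induce the same equivalence class in $S_K^{X_3}\times\{-1,1\}$.
   Context: For a field $K$ and a poset $X$, the incidence space $I(X,K)$ is the $K$-space of functions $f:X\times X\to K$ with $f(x,y)=0$ whenever $x\nleq y$. The finitary incidence algebra $FI(X,K)$ is the subspace of all $f\in I(X,K)$ such that for all $x\le y$ in $X$ there are only finitely many subintervals $[u,v]\subseteq[x,y]$ with $u\ne v$ and $f(u,v)\neq 0$. It is an associative unital $K$-algebra, with unity $\delta$, under convolution $(fg)(x,y)=\sum_{x\le z\le y}f(x,z)g(z,y)$, and the same formula makes $I(X,K)$ an $FI(X,K)$-bimodule. $D(X,K)$ is the $K$-algebra $FI(X,K)\oplus I(X,K)$, elements written as columns, with multiplication $\begin{bmatrix}f\\ i\end{bmatrix}\begin{bmatrix}g\\ j\end{bmatrix}=\begin{bmatrix}fg\\ fj+ig\end{bmatrix}$. Inner automorphisms of an algebra are the maps $a\mapsto uau^{-1}$, $u$ a unit. An involution on a $K$-algebra is a $K$-linear anti-automorphism whose square is the identity; an involution on a poset $X$ is a bijection $\lambda$ with $x\le y\Leftrightarrow\lambda(y)\le\lambda(x)$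 and $\lambda^2=\mathrm{id}$. A poset is connected if any two elements are joined by a finite sequence in which consecutive elements are comparable. Involutions $\phi,\varphi$ on an algebra are equivalent via inner automorphism if $\Psi\circ\phi=\varphi\circ\Psi$ for some inner automorphism $\Psi$. A multiplicative automorphism of $FI(X,K)$ is a map $M_\sigma(f)(x,y)=\sigma(x,y)f(x,y)$, where $\sigma\in I(X,K)$ satisfies $\sigma(x,y)\neq0$ for all $x\le y$ and $\sigma(x,y)\sigma(y,z)=\sigma(x,z)$ for $x\le y\le z$. A derivation $D:FI(X,K)\to I(X,K)$ is a $K$-linear map with $D(fg)=D(f)g+fD(g)$; it is inner if there is $i\in I(X,K)$ with $D(f)=fi-if$ for all $f$. Let $e_x\in FI(X,K)$ be $1$ at $(x,x)$ and $0$ elsewhere. An involution $\Phi$ on $D(X,K)$ induces the involution $\lambda$ on $X$ such that $\Phi\left(\begin{bmatrix}e_x\\0\end{bmatrix}\right)$ is conjugate to $\begin{bmatrix}e_{\lambda(x)}\\0\end{bmatrix}$ for every $x\in X$. Set $\rho_\lambda(f)(x,y)=f(\lambda(y),\lambda(x))$ for $f\in FI(X,K)$, let $\overline{\rho_\lambda}$ be given by the same formula on $I(X,K)$, and $\widetilde{\rho_\lambda}\left(\begin{bmatrix}f\\ i\end{bmatrix}\right)=\begin{bmatrix}\rho_\lambda(f)\\ \overline{\rho_\lambda}(i)\end{bmatrix}$. For $k\in K^*$, $\widetilde{k\delta}\left(\begin{bmatrix}f\\ i\end{bmatrix}\right)=\begin{bmatrix}f\\ ki\end{bmatrix}$. Under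 the stated hypotheses, every involution $\Phi$ on $D(X,K)$ has the form $\Phi=\Psi\circ\widetilde{\rho_\lambda}\circ\widetilde{k\delta}$ with $\Psi$ inner, $\lambda$ the involution induced by $\Phi$, and $k\in\{-1,1\}$ uniquely determined; $k$ is the sign $s(\Phi)$ of $\Phi$. For a map $\epsilon:X_3\to K^*$, let $u_\epsilon\in FI(X,K)$ be the diagonal function with $u_\epsilon(x,x)=\epsilon(x)$ for $x\in X_3$ and $u_\epsilon(x,x)=1$ for $x\notin X_3$. Then $\rho_\epsilon(f)=u_\epsilon\rho_\lambda(f)u_\epsilon^{-1}$ is an involution on $FI(X,K)$, and $\widetilde{\rho_\epsilon}\left(\begin{bmatrix}f\\ i\end{bmatrix}\right)=\begin{bmatrix}u_\epsilon\rho_\lambda(f)u_\epsilon^{-1}\\ u_\epsilon\overline{\rho_\lambda}(i)u_\epsilon^{-1}\end{bmatrix}$. Let $S_K=K^*/(K^* )^2$, let $\pi:K^*\to S_K$ be the canonical homomorphism, and put $\chi_\epsilon=\pi\circ\epsilon:X_3\to S_K$. $S_K^{X_3}$ is the set of all maps $X_3\to S_K$. On $S_K^{X_3}\times\{-1,1\}$, $(\chi,a)$ and $(\chi',b)$ are equivalent if $a=b$ and there is $g\in S_K$ with $\chi(x)=g\chi'(x)$ for all $x\in X_3$. Every involution $\Phi$ on $D(X,K)$ inducing $\lambda$ is equivalent, via inner automorphism, to $\widetilde{\rho_\epsilon}\circ\widetilde{s(\Phi)\delta}$ for some $\epsilon:X_3\to K^*$; the class induced by $\Phi$ is the equivalence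 class of $(\chi_\epsilon,s(\Phi))$ (independent of the choice of $\epsilon$). *)

(* Defs.v *)
From HB Require Import structures.
From mathcomp Require Import all_boot all_order all_algebra generic_quotient.
From mathcomp Require Import mathcomp_extra boolp classical_sets functions.
From mathcomp Require Import cardinality fsbigop.

Set Implicit Arguments.
Unset Strict Implicit.
Unset Printing Implicit Defensive.

Import Order.TTheory GRing.Theory.

Local Open Scope classical_set_scope.
Local Open Scope ring_scope.

Section Incidence.
Context {disp : Order.disp_t} (X : porderType disp) (K : fieldType).

Definition incidence_pred : {pred X -> X -> K} :=
  [pred f | `[< forall x y, ~~ (x <= y)%O -> f x y = 0 >]].

Record incidence := Incidence {
  incidence_fun :> X -> X -> K;
  _ : incidence_pred incidence_fun
}.

HB.instance Definition _ := [isSub for incidence_fun].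
HB.instance Definition _ := [Choice of incidence by <:].

Lemma incidence_zmod_closed : zmod_closed incidence_pred.
Proof.
split=> [|f g /asboolP f0 /asboolP g0]; apply/asboolP => x y xy //.
by rewrite [LHS](_ : _ = f x y - g x y) // f0 // g0 // subr0.
Qed.

HB.instance Definition _ :=
  GRing.isZmodClosed.Build _ incidence_pred incidence_zmod_closed.
HB.instance Definition _ := [SubChoice_isSubZmodule of incidence by <:].

Lemma incidence0 (f : incidence) x y : ~~ (x <= y)%O -> f x y = 0.
Proof. by case: f => f /= /asboolP; apply. Qed.

Lemma incidence_le (f : incidence) x y : f x y != 0 -> (x <= y)%O.
Proof. by apply: contraNT => /incidence0 ->. Qed.

Lemma incidenceP (f g : incidence) : (forall x y, f x y = g x y) <-> f = g.
Proof.
by split=> [fg|-> //]; apply: val_inj; apply/funext => x; apply/funext => y.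
Qed.

Lemma incD (f g : incidence) x y : (f + g) x y = f x y + g x y.
Proof. by []. Qed.

Lemma scale_subproof (c : K) (f : incidence) :
  incidence_pred (fun x y => c * f x y).
Proof. by apply/asboolP => x y /incidence0 ->; rewrite mulr0. Qed.

Definition scale_inc c f := Incidence (scale_subproof c f).

Fact scale_incA a b f : scale_inc a (scale_inc b f) = scale_inc (a * b) f.
Proof. by apply/incidenceP => x y /=; rewrite mulrA. Qed.
Fact scale_inc1 : left_id 1 scale_inc.
Proof. by move=> f; apply/incidenceP => x y /=; rewrite mul1r. Qed.
Fact scale_incDr : right_distributive scale_inc +%R.
Proof. by move=> a f g; apply/incidenceP => x y; exact: mulrDr. Qed.
Fact scale_incDl f : {morph scale_inc^~ f : a b / a + b}.
Proof. by move=> a b; apply/incidenceP => x y; exact: mulrDl. Qed.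

HB.instance Definition _ := GRing.Zmodule_isLmodule.Build K incidence
  scale_incA scale_inc1 scale_incDr scale_incDl.

Lemma incZ c (f : incidence) x y : (c *: f) x y = c * f x y.
Proof. by []. Qed.

(* The sum is meaningful (finitely supported) as soon as one of the factors is *)
(* finitary; otherwise \sum_(z \in _) may take its default value 0.            *)
Definition conv_fun (f g : incidence) x y : K :=
  \sum_(z \in [set z | (x <= z)%O && (z <= y)%O]) f x z * g z y.

Lemma conv_subproof f g : incidence_pred (conv_fun f g).
Proof.
apply/asboolP => x y xy; apply: fsbig1 => z /= /andP[xz zy].
by rewrite (le_trans xz zy) in xy.
Qed.

Definition conv f g := Incidence (conv_subproof f g).

(* p stands for the subinterval [p.1, p.2] of [x, y], with p.1 <> p.2. *)
Definition finitary (f : incidence) : Prop :=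
  forall x y, (x <= y)%O ->
    finite_set [set p : X * X | [/\ (x <= p.1)%O, (p.1 < p.2)%O, (p.2 <= y)%O
                                  & f p.1 p.2 != 0]].

Definition finc_pred : {pred incidence} := [pred f | `[< finitary f >]].

Record finc := Finc { finc_inc :> incidence; _ : finc_pred finc_inc }.

HB.instance Definition _ := [isSub for finc_inc].
HB.instance Definition _ := [Choice of finc by <:].

Lemma finc_submod_closed : submod_closed finc_pred.
Proof.
split=> [|c f g /asboolP ff /asboolP fg]; apply/asboolP => x y xy.
  by apply: (sub_finite_set (B := set0)) => //= p [_ _ _ /eqP].
have := conj (ff x y xy) (fg x y xy); rewrite -finite_setU.
apply: sub_finite_set => p /= [xp p12 py].
rewrite [X in X != 0](_ : _ = c * f p.1 p.2 + g p.1 p.2) // => nz.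
have [f0|f0] := eqVneq (f p.1 p.2) 0; last by left.
by right; split=> //; rewrite f0 mulr0 add0r in nz.
Qed.

HB.instance Definition _ :=
  GRing.isSubmodClosed.Build K incidence finc_pred finc_submod_closed.
HB.instance Definition _ := [SubChoice_isSubLmodule of finc by <:].

Lemma fincP (f : finc) : finitary f.
Proof. by case: f => f /= /asboolP. Qed.

Lemma fincDE (f g : finc) x y : (f + g : finc) x y = f x y + g x y.
Proof. by []. Qed.

Lemma finc_eq (f g : finc) : (forall x y, f x y = g x y) -> f = g.
Proof. by move=> fg; apply: val_inj; apply/incidenceP. Qed.

Lemma finc_row (f : finc) x y : finite_set [set z | (z <= y)%O /\ f x z != 0].
Proof.
have [xy|xy] := boolP (x <= y)%O; last first.
  apply: (sub_finite_set (B := set0)) => //= z [zy /incidence_le xz].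
  by rewrite (le_trans xz zy) in xy.
apply: (@sub_finite_set _ _ ([set x] `|` snd @` [set p : X * X |
  [/\ (x <= p.1)%O, (p.1 < p.2)%O, (p.2 <= y)%O & f p.1 p.2 != 0]])).
  move=> z [zy fz]; have := incidence_le fz.
  by rewrite le_eqVlt => /predU1P[->|xz]; [left|right; exists (x, z)].
by rewrite finite_setU; split; [exact: finite_set1|
  apply: finite_image; exact: fincP].
Qed.

Lemma finc_col (f : finc) x y : finite_set [set z | (x <= z)%O /\ f z y != 0].
Proof.
have [xy|xy] := boolP (x <= y)%O; last first.
  apply: (sub_finite_set (B := set0)) => //= z [xz /incidence_le zy].
  by rewrite (le_trans xz zy) in xy.
apply: (@sub_finite_set _ _ ([set y] `|` fst @` [set p : X * X |
  [/\ (x <= p.1)%O, (p.1 < p.2)%O, (p.2 <= y)%O & f p.1 p.2 != 0]])).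
  move=> z [xz fz]; have := incidence_le fz.
  by rewrite le_eqVlt => /predU1P[->|zy]; [left|right; exists (z, y)].
by rewrite finite_setU; split; [exact: finite_set1|
  apply: finite_image; exact: fincP].
Qed.

Lemma convE (S : set X) (f g : incidence) x y :
    (forall z, f x z * g z y != 0 -> S z) ->
  conv f g x y = \sum_(z \in S) f x z * g z y.
Proof.
move=> supp; rewrite /= /conv_fun fsbig_supp [RHS]fsbig_supp.
apply: eq_fsbigl; apply/seteqP; split=> z [Az /= /eqP nz]; split=> //=.
- exact: supp.
- exact/eqP.
- move: nz; rewrite mulf_eq0 negb_or => /andP[/incidence_le -> /incidence_le].
  by [].
- exact/eqP.
Qed.

Lemma conv_neq0 (f g : incidence) x y : conv f g x y != 0 ->
  exists2 z, (x <= z <= y)%O & f x z * g z y != 0.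
Proof. by move=> /(fsbigN1 (f := fun x z => f x z * g z y))[z xzy nz]; exists z. Qed.

Lemma conv_assoc_at (W Z : set X) (f g h : incidence) x y :
    finite_set W -> finite_set Z ->
    (forall w z, f x w * g w z * h z y != 0 -> W w /\ Z z) ->
  conv (conv f g) h x y = conv f (conv g h) x y.
Proof.
move=> finW finZ supp.
rewrite (convE (S := Z)); last first.
  move=> z; rewrite mulf_eq0 negb_or => /andP[/conv_neq0[w _ nz] hz].
  by case: (supp w z _) => //; rewrite mulf_neq0.
rewrite (convE (S := W)); last first.
  move=> w; rewrite mulf_eq0 negb_or => /andP[fw /conv_neq0[z _ nz]].
  by case: (supp w z _) => //; rewrite -mulrA mulf_neq0.
transitivity (\sum_(z \in Z) \sum_(w \in W) f x w * g w z * h z y).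
  apply: eq_fsbigr => z _; rewrite -mulr_fsuml.
  have [->|hz] := eqVneq (h z y) 0; first by rewrite !mulr0.
  rewrite (convE (S := W)) // => w nz.
  by case: (supp w z _) => //; rewrite mulf_neq0.
rewrite exchange_fsbig //; apply: eq_fsbigr => w _.
transitivity (f x w * \sum_(z \in Z) g w z * h z y).
  by rewrite mulr_fsumr; apply: eq_fsbigr => z _; rewrite mulrA.
have [->|fw] := eqVneq (f x w) 0; first by rewrite !mul0r.
rewrite [in RHS](convE (S := Z)) // => z nz.
by case: (supp w z _) => //; rewrite -mulrA mulf_neq0.
Qed.

Lemma convA_ffi (f g : finc) (i : incidence) :
  conv (conv f g) i = conv f (conv g i).
Proof.
apply/incidenceP => x y.
pose W := [set w | (w <= y)%O /\ f x w != 0].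
have finW : finite_set W by exact: finc_row.
apply: (@conv_assoc_at W (\bigcup_(w in W) [set z | (z <= y)%O /\ g w z != 0])).
- exact: finW.
- by apply: bigcup_finite => // w _; exact: finc_row.
move=> w z; rewrite !mulf_eq0 !negb_or -andbA => /and3P[fw gz iz].
have zy := incidence_le iz; have wy := le_trans (incidence_le gz) zy.
by split=> //; exists w.
Qed.

Lemma convA_fif (f g : finc) (i : incidence) :
  conv (conv f i) g = conv f (conv i g).
Proof.
apply/incidenceP => x y.
apply: (conv_assoc_at (finc_row f x y) (finc_col g x y)).
move=> w z; rewrite !mulf_eq0 !negb_or -andbA => /and3P[fw iz gz].
have wz := incidence_le iz.
by split; split=> //; [apply: le_trans wz (incidence_le gz)
  | apply: le_trans (incidence_le fw) wz].
Qed.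

Lemma convA_iff (f g : finc) (i : incidence) :
  conv (conv i f) g = conv i (conv f g).
Proof.
apply/incidenceP => x y.
pose Z := [set z | (x <= z)%O /\ g z y != 0].
have finZ : finite_set Z by exact: finc_col.
apply: (@conv_assoc_at (\bigcup_(z in Z) [set w | (x <= w)%O /\ f w z != 0]) Z).
- by apply: bigcup_finite => // z _; exact: finc_col.
- exact: finZ.
move=> w z; rewrite !mulf_eq0 !negb_or -andbA => /and3P[iw fz gz].
have xw := incidence_le iw; have xz := le_trans xw (incidence_le fz).
by split=> //; exists z.
Qed.

Lemma finc_row_sub (f : finc) (i : incidence) x y z :
  f x z * i z y != 0 -> [set z | (z <= y)%O /\ f x z != 0] z.
Proof. by rewrite mulf_eq0 negb_or => /andP[? /incidence_le]. Qed.

Lemma finc_col_sub (f : finc) (i : incidence) x y z :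
  i x z * f z y != 0 -> [set z | (x <= z)%O /\ f z y != 0] z.
Proof. by rewrite mulf_eq0 negb_or => /andP[/incidence_le]. Qed.

Lemma conv_fDr (f : finc) (i j : incidence) :
  conv f (i + j) = conv f i + conv f j.
Proof.
apply/incidenceP => x y; rewrite incD.
rewrite !(convE (@finc_row_sub f _ x y)) -fsbig_split; last exact: finc_row.
by apply: eq_fsbigr => z _; rewrite incD mulrDr.
Qed.

Lemma conv_fDl (f : finc) (i j : incidence) :
  conv (i + j) f = conv i f + conv j f.
Proof.
apply/incidenceP => x y; rewrite incD.
rewrite !(convE (@finc_col_sub f _ x y)) -fsbig_split; last exact: finc_col.
by apply: eq_fsbigr => z _; rewrite incD mulrDl.
Qed.

Lemma conv_Dlf (f g : finc) (i : incidence) :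
  conv (f + g : finc) i = conv f i + conv g i.
Proof.
apply/incidenceP => x y; rewrite incD.
pose S := [set z | (z <= y)%O /\ f x z != 0] `|`
          [set z | (z <= y)%O /\ g x z != 0].
have finS : finite_set S by rewrite finite_setU; split; exact: finc_row.
have fS z : f x z * i z y != 0 -> S z by move=> /finc_row_sub; left.
have gS z : g x z * i z y != 0 -> S z by move=> /finc_row_sub; right.
rewrite (convE fS) (convE gS) (convE (S := S)).
  rewrite -fsbig_split; last exact: finS.
  by apply: eq_fsbigr => z _; rewrite fincDE mulrDl.
move=> z; rewrite fincDE mulrDl => nz; have [f0|] := eqVneq (f x z * i z y) 0; last exact: fS.
by apply: gS; rewrite f0 add0r in nz.
Qed.

Lemma conv_Drf (f g : finc) (i : incidence) :
  conv i (f + g : finc) = conv i f + conv i g.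
Proof.
apply/incidenceP => x y; rewrite incD.
pose S := [set z | (x <= z)%O /\ f z y != 0] `|`
          [set z | (x <= z)%O /\ g z y != 0].
have finS : finite_set S by rewrite finite_setU; split; exact: finc_col.
have fS z : i x z * f z y != 0 -> S z by move=> /finc_col_sub; left.
have gS z : i x z * g z y != 0 -> S z by move=> /finc_col_sub; right.
rewrite (convE fS) (convE gS) (convE (S := S)).
  rewrite -fsbig_split; last exact: finS.
  by apply: eq_fsbigr => z _; rewrite fincDE mulrDr.
move=> z; rewrite fincDE mulrDr => nz; have [f0|] := eqVneq (i x z * f z y) 0; last exact: fS.
by apply: gS; rewrite f0 add0r in nz.
Qed.

Lemma convZl c (i j : incidence) : conv (c *: i) j = c *: conv i j.
Proof.
apply/incidenceP => x y; rewrite incZ /= /conv_fun mulr_fsumr.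
by apply: eq_fsbigr => z _; rewrite incZ mulrA.
Qed.

Lemma convZr c (i j : incidence) : conv i (c *: j) = c *: conv i j.
Proof.
apply/incidenceP => x y; rewrite incZ /= /conv_fun mulr_fsumr.
by apply: eq_fsbigr => z _; rewrite incZ mulrCA.
Qed.

Lemma conv_finitary (f g : finc) : finc_pred (conv f g).
Proof.
apply/asboolP => x y xy.
pose A (h : incidence) := [set p : X * X |
  [/\ (x <= p.1)%O, (p.1 < p.2)%O, (p.2 <= y)%O & h p.1 p.2 != 0]].
have finf : finite_set (A f) by exact: fincP.
have fing : finite_set (A g) by exact: fincP.
apply: (@sub_finite_set _ _ ((A f `|` A g) `|`
   (fun pq : (X * X) * (X * X) => (pq.1.1, pq.2.2)) @` (A f `*` A g))).
  move=> [u v] /= [xu uv vy /conv_neq0[z /andP[uz zv]]].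
  rewrite mulf_eq0 negb_or => /andP[fz gz].
  move: uz; rewrite le_eqVlt => /predU1P[zu|uz].
    by left; right; rewrite -zu in gz.
  move: zv; rewrite le_eqVlt => /predU1P[zv|zv].
    by left; left; rewrite zv in fz.
  right; exists ((u, z), (z, v)) => //=; split; split=> //=.
    exact: le_trans (ltW zv) vy.
  exact: le_trans xu (ltW uz).
rewrite !finite_setU; split=> //.
by apply: finite_image; exact: finite_setX.
Qed.

Definition finc_mul (f g : finc) : finc := Finc (conv_finitary f g).

Lemma diag_subproof (d : X -> K) :
  incidence_pred (fun x y => if x == y then d x else 0).
Proof. by apply/asboolP => x y; case: eqVneq => // ->; rewrite lexx. Qed.

Lemma diag_finitary d : finc_pred (Incidence (diag_subproof d)).
Proof.
apply/asboolP => x y xy; apply: (sub_finite_set (B := set0)) => //= p.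
by case=> _ p12 _; rewrite (lt_eqF p12) eqxx.
Qed.

Definition diag (d : X -> K) : finc := Finc (diag_finitary d).

Lemma conv_diagl d (i : incidence) x y : conv (diag d) i x y = d x * i x y.
Proof.
rewrite (convE (S := [set x])); first by rewrite fsbig_set1 /= eqxx.
by move=> z /=; have [->|] := eqVneq x z; rewrite // mul0r eqxx.
Qed.

Lemma conv_diagr d (i : incidence) x y : conv i (diag d) x y = i x y * d y.
Proof.
rewrite (convE (S := [set y])); first by rewrite fsbig_set1 /= eqxx.
by move=> z /=; have [->|] := eqVneq z y; rewrite // mulr0 eqxx.
Qed.

Definition finc_delta : finc := diag (fun=> 1).

Lemma conv_1l (i : incidence) : conv finc_delta i = i.
Proof. by apply/incidenceP => x y; rewrite conv_diagl mul1r. Qed.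

Lemma conv_1r (i : incidence) : conv i finc_delta = i.
Proof. by apply/incidenceP => x y; rewrite conv_diagr mulr1. Qed.

Fact finc_mulA : associative finc_mul.
Proof. by move=> f g h; apply: val_inj; rewrite /= convA_ffi. Qed.
Fact finc_mul1l : left_id finc_delta finc_mul.
Proof. by move=> f; apply: val_inj; rewrite /= conv_1l. Qed.
Fact finc_mul1r : right_id finc_delta finc_mul.
Proof. by move=> f; apply: val_inj; rewrite /= conv_1r. Qed.
Fact finc_mulDl : left_distributive finc_mul +%R.
Proof. by move=> f g h; apply: val_inj; rewrite /= conv_fDl. Qed.
Fact finc_mulDr : right_distributive finc_mul +%R.
Proof. by move=> f g h; apply: val_inj; rewrite /= conv_fDr. Qed.

HB.instance Definition _ := GRing.Zmodule_isPzRing.Build finc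
  finc_mulA finc_mul1l finc_mul1r finc_mulDl finc_mulDr.

(* FI(X, K) and D(X, K) are zero rings when X is empty, so that they cannot be *)
(* MathComp algTypes; the compatibility of scaling and product is stated apart. *)
Fact finc_scaleAl (c : K) (f g : finc) : c *: (f * g) = c *: f * g.
Proof. by apply: val_inj; rewrite /= convZl. Qed.

Fact finc_scaleAr (c : K) (f g : finc) : c *: (f * g) = f * (c *: g).
Proof. by apply: val_inj; rewrite /= convZr. Qed.


(* The column (f, i) is the pair (f, i). *)
Definition Dalg : Type := (finc * incidence)%type.

HB.instance Definition _ := GRing.Lmodule.on Dalg.

Definition Dmul (a b : Dalg) : Dalg :=
  (a.1 * b.1, conv a.1 b.2 + conv a.2 b.1).

Definition Done : Dalg := (1, 0).

Fact DmulA : associative Dmul.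
Proof.
case=> [f i] [g j] [h k]; congr pair; rewrite /= ?mulrA //.
by rewrite conv_fDr conv_fDl convA_ffi convA_fif convA_iff addrA.
Qed.
Fact conv_f0 (f : finc) : conv f 0 = 0.
Proof. by rewrite -[0 in LHS](scale0r 0) convZr scale0r. Qed.
Fact conv_0f (f : finc) : conv 0 f = 0.
Proof. by rewrite -[0 in LHS](scale0r 0) convZl scale0r. Qed.
Fact Dmul1l : left_id Done Dmul.
Proof. by case=> f i; congr pair; rewrite /= ?mul1r // conv_1l conv_0f addr0. Qed.
Fact Dmul1r : right_id Done Dmul.
Proof. by case=> f i; congr pair; rewrite /= ?mulr1 // conv_1r conv_f0 add0r. Qed.
Fact DmulDl : left_distributive Dmul +%R.
Proof.
case=> [f i] [g j] [h k]; congr pair; rewrite /= ?mulrDl //.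
by rewrite conv_Dlf conv_fDl addrACA.
Qed.
Fact DmulDr : right_distributive Dmul +%R.
Proof.
case=> [f i] [g j] [h k]; congr pair; rewrite /= ?mulrDr //.
by rewrite conv_Drf conv_fDr addrACA.
Qed.

HB.instance Definition _ := GRing.Zmodule_isPzRing.Build Dalg
  DmulA Dmul1l Dmul1r DmulDl DmulDr.

Fact Dalg_scaleAl (c : K) (a b : Dalg) : c *: (a * b) = c *: a * b.
Proof.
case: a b => [f i] [g j]; congr pair; first exact: finc_scaleAl.
by rewrite [LHS](scalerDr c (conv f j) (conv i g)) -!convZl.
Qed.

Fact Dalg_scaleAr (c : K) (a b : Dalg) : c *: (a * b) = a * (c *: b).
Proof.
case: a b => [f i] [g j]; congr pair; first exact: finc_scaleAr.
by rewrite [LHS](scalerDr c (conv f j) (conv i g)) -!convZr.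
Qed.

End Incidence.

Arguments incidence {disp} X K.
Arguments finc {disp} X K.
Arguments Dalg {disp} X K.

Section Rings.
Variable A : pzRingType.

Definition inner_automorphism (Psi : A -> A) : Prop :=
  exists u v : A, [/\ u * v = 1, v * u = 1 & forall a, Psi a = u * a * v].

Definition conjugate (a b : A) : Prop :=
  exists u v : A, [/\ u * v = 1, v * u = 1 & b = u * a * v].

Definition inner_equivalent (Phi Phi' : A -> A) : Prop :=
  exists2 Psi, inner_automorphism Psi & Psi \o Phi =1 Phi' \o Psi.

End Rings.

Definition poset_involution {disp} {X : porderType disp} (lam : X -> X) : Prop :=
  (forall x y, (x <= y)%O = (lam y <= lam x)%O) /\ involutive lam.

Definition poset_connected {disp} (X : porderType disp) : Prop :=
  forall x y : X, exists s : seq X,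
    path (fun a b => (a >=< b)%O) x s /\ last x s = y.

(* Kstar is K^*; sqr_class is S_K, the quotient of K^* by its squares. *)
Section SquareClasses.
Variable K : fieldType.

Definition Kstar : Type := {x : K | x != 0}.
HB.instance Definition _ := Choice.on Kstar.

Fact Kstar_one_subproof : (1 : K) != 0. Proof. exact: oner_neq0. Qed.
Fact Kstar_mul_subproof (a b : Kstar) : val a * val b != 0.
Proof. by rewrite mulf_neq0 ?(valP a) ?(valP b). Qed.
Fact Kstar_inv_subproof (a : Kstar) : (val a)^-1 != 0.
Proof. by rewrite invr_eq0 (valP a). Qed.

Definition Kstar_one : Kstar := exist (fun x : K => x != 0) 1 Kstar_one_subproof.
Definition Kstar_mul (a b : Kstar) : Kstar :=
  exist (fun x : K => x != 0) _ (Kstar_mul_subproof a b).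
Definition Kstar_inv (a : Kstar) : Kstar :=
  exist (fun x : K => x != 0) _ (Kstar_inv_subproof a).

Fact Kstar_mulA : associative Kstar_mul.
Proof. by move=> a b c; apply: val_inj; rewrite /= mulrA. Qed.
Fact Kstar_mul1 : left_id Kstar_one Kstar_mul.
Proof. by move=> a; apply: val_inj; rewrite /= mul1r. Qed.
Fact Kstar_mulr1 : right_id Kstar_one Kstar_mul.
Proof. by move=> a; apply: val_inj; rewrite /= mulr1. Qed.
Fact Kstar_mulV : left_inverse Kstar_one Kstar_inv Kstar_mul.
Proof. by move=> a; apply: val_inj; rewrite /= mulVf // (valP a). Qed.
Fact Kstar_mulrV : right_inverse Kstar_one Kstar_inv Kstar_mul.
Proof. by move=> a; apply: val_inj; rewrite /= mulfV // (valP a). Qed.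

HB.instance Definition _ := isGroup.Build Kstar
  Kstar_mulA Kstar_mul1 Kstar_mulr1 Kstar_mulV Kstar_mulrV.

Fact Kstar_mulC (a b : Kstar) : (a * b = b * a)%g.
Proof. by apply: val_inj; rewrite /= mulrC. Qed.

Definition sqr_equiv (a b : Kstar) : bool :=
  `[< exists c : Kstar, (a = b * (c * c))%g >].

Fact sqr_equiv_refl : reflexive sqr_equiv.
Proof. by move=> a; apply/asboolP; exists 1%g; rewrite !mulg1. Qed.
Fact sqr_equiv_symT a b : sqr_equiv a b -> sqr_equiv b a.
Proof.
move=> /asboolP[c ->]; apply/asboolP; exists (c^-1)%g.
by rewrite -invgM mulgK.
Qed.
Fact sqr_equiv_sym : symmetric sqr_equiv.
Proof. by move=> a b; apply/idP/idP; exact: sqr_equiv_symT. Qed.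
Fact sqr_equiv_trans : transitive sqr_equiv.
Proof.
move=> b a c /asboolP[d ->] /asboolP[e ->]; apply/asboolP; exists (e * d)%g.
by apply: val_inj; rewrite /= -mulrA mulrACA.
Qed.

Canonical sqr_equiv_rel :=
  EquivRel sqr_equiv sqr_equiv_refl sqr_equiv_sym sqr_equiv_trans.

Definition sqr_class : Type := {eq_quot sqr_equiv}%qT.
HB.instance Definition _ := Choice.on sqr_class.
HB.instance Definition _ := EqQuotient.on sqr_class.

Definition sqr_proj (a : Kstar) : sqr_class := (\pi_sqr_class a)%qT.

Definition sqr_class_one : sqr_class := sqr_proj 1%g.
Definition sqr_class_mul (a b : sqr_class) : sqr_class :=
  sqr_proj (repr a * repr b)%g.
Definition sqr_class_inv (a : sqr_class) : sqr_class := sqr_proj (repr a)^-1%g.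

Lemma sqr_projP a b : sqr_proj a = sqr_proj b <-> exists c, (a = b * (c * c))%g.
Proof.
rewrite /sqr_proj; split=> [/eqP|abc]; first by rewrite eqmodE => /asboolP.
by apply/eqP; rewrite eqmodE; apply/asboolP.
Qed.

Lemma sqr_class_mulE a b :
  sqr_class_mul (sqr_proj a) (sqr_proj b) = sqr_proj (a * b)%g.
Proof.
rewrite /sqr_class_mul; apply/sqr_projP.
have /sqr_projP[c ->] : sqr_proj (repr (sqr_proj a)) = sqr_proj a by exact: reprK.
have /sqr_projP[d ->] : sqr_proj (repr (sqr_proj b)) = sqr_proj b by exact: reprK.
exists (c * d)%g; apply: val_inj => /=.
by rewrite mulrACA; congr (_ * _); rewrite mulrACA.
Qed.

Fact sqr_class_ind (P : sqr_class -> Prop) :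
  (forall a, P (sqr_proj a)) -> forall x, P x.
Proof. by move=> Pa x; rewrite -[x]reprK; exact: Pa. Qed.

Fact sqr_class_invE a : sqr_class_inv (sqr_proj a) = sqr_proj a^-1%g.
Proof.
rewrite /sqr_class_inv; apply/sqr_projP.
have /sqr_projP[c ->] : sqr_proj (repr (sqr_proj a)) = sqr_proj a by exact: reprK.
by exists (c^-1)%g; rewrite !invgM Kstar_mulC.
Qed.

Fact sqr_class_mulA : associative sqr_class_mul.
Proof.
elim/sqr_class_ind => a; elim/sqr_class_ind => b; elim/sqr_class_ind => c.
by rewrite !sqr_class_mulE mulgA.
Qed.
Fact sqr_class_mul1 : left_id sqr_class_one sqr_class_mul.
Proof. by elim/sqr_class_ind => a; rewrite sqr_class_mulE mul1g. Qed.
Fact sqr_class_mulr1 : right_id sqr_class_one sqr_class_mul.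
Proof. by elim/sqr_class_ind => a; rewrite sqr_class_mulE mulg1. Qed.
Fact sqr_class_mulV : left_inverse sqr_class_one sqr_class_inv sqr_class_mul.
Proof.
by elim/sqr_class_ind => a; rewrite sqr_class_invE sqr_class_mulE mulVg.
Qed.
Fact sqr_class_mulrV : right_inverse sqr_class_one sqr_class_inv sqr_class_mul.
Proof.
by elim/sqr_class_ind => a; rewrite sqr_class_invE sqr_class_mulE mulgV.
Qed.

HB.instance Definition _ := isGroup.Build sqr_class
  sqr_class_mulA sqr_class_mul1 sqr_class_mulr1 sqr_class_mulV sqr_class_mulrV.

Fact sqr_projM (a b : Kstar) :
  sqr_proj (a * b)%g = (sqr_proj a * sqr_proj b)%g.
Proof. by rewrite -sqr_class_mulE. Qed.

End SquareClasses.

Section Involutions.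
Context {disp : Order.disp_t} {X : porderType disp} {K : fieldType}.
Implicit Types (f g u v : finc X K) (i s : incidence X K).

Definition Dinvolution (Phi : Dalg X K -> Dalg X K) : Prop :=
  [/\ linear Phi, forall a b, Phi (a * b) = Phi b * Phi a & involutive Phi].

Definition multiplicative s : Prop :=
  (forall x y, (x <= y)%O -> s x y != 0) /\
  (forall x y z, (x <= y)%O -> (y <= z)%O -> s x y * s y z = s x z).

Fact mult_aut_subproof s f : incidence_pred (fun x y => s x y * f x y).
Proof. by apply/asboolP => x y xy; rewrite (incidence0 f xy) mulr0. Qed.

Fact mult_aut_finitary s f : finc_pred (Incidence (mult_aut_subproof s f)).
Proof.
apply/asboolP => x y xy; apply: sub_finite_set (fincP f xy) => p /= [? ? ?].
by rewrite mulf_eq0 negb_or => /andP[_ ?].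
Qed.

Definition mult_aut s f : finc X K := Finc (mult_aut_finitary s f).

Definition derivation (Der : finc X K -> incidence X K) : Prop :=
  linear Der /\ forall f g, Der (f * g) = conv (Der f) g + conv f (Der g).

Definition inner_derivation (Der : finc X K -> incidence X K) : Prop :=
  exists i, forall f, Der f = conv f i - conv i f.

Definition e_ (x : X) : finc X K := diag (fun y => (y == x)%:R).

Definition induces (Phi : Dalg X K -> Dalg X K) (lam : X -> X) : Prop :=
  forall x, conjugate (Phi (e_ x, 0)) (e_ (lam x), 0).

End Involutions.

(* That lam is an involution is what keeps rho f finitary, hence the argument lamP. *)
Section Rho.
Context {disp : Order.disp_t} {X : porderType disp} {K : fieldType}.
Variables (lam : X -> X) (lamP : poset_involution lam).
Implicit Types (f : finc X K) (i : incidence X K).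

Fact rho_subproof i : incidence_pred (fun x y => i (lam y) (lam x)).
Proof.
by apply/asboolP => x y; case: lamP => -> _; exact: incidence0.
Qed.

Definition rho_inc i : incidence X K := Incidence (rho_subproof i).

Fact rho_finitary f : finc_pred (rho_inc f).
Proof.
case: lamP => lamE lamK; apply/asboolP => x y; rewrite lamE => xy.
have : finite_set ((fun p : X * X => (lam p.2, lam p.1)) @` [set p : X * X |
  [/\ (lam y <= p.1)%O, (p.1 < p.2)%O, (p.2 <= lam x)%O & f p.1 p.2 != 0]]).
  by apply: finite_image; exact: fincP.
apply: sub_finite_set => -[u v] /= [xu uv vy nz].
exists (lam v, lam u); rewrite /= ?lamK //; split=> //.
- by rewrite -lamE.
- rewrite lt_neqAle -lamE (ltW uv) andbT; apply: contraTneq uv.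
  by move=> /(can_inj lamK) ->; rewrite ltxx.
- by rewrite -lamE.
Qed.

Definition rho f : finc X K := Finc (rho_finitary f).

Definition Drho (a : Dalg X K) : Dalg X K := (rho a.1, rho_inc a.2).

Definition Dk (k : K) (a : Dalg X K) : Dalg X K := (a.1, k *: a.2).

Definition fixed_point : Type := {x : X | lam x == x}.

Definition u_eps (eps : fixed_point -> Kstar K) : finc X K :=
  diag (fun x => if insub x is Some z then val (eps z) else 1).
Definition u_eps_inv (eps : fixed_point -> Kstar K) : finc X K :=
  diag (fun x => if insub x is Some z then (val (eps z))^-1 else 1).

Lemma u_epsK eps : u_eps eps * u_eps_inv eps = 1.
Proof.
apply: finc_eq => x y; rewrite [LHS]conv_diagl /=.
case: eqVneq => // _; last by rewrite mulr0.
by case: insub => [z|]; rewrite ?mulr1 // mulfV // (valP (eps z)).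
Qed.
Lemma u_epsVK eps : u_eps_inv eps * u_eps eps = 1.
Proof.
apply: finc_eq => x y; rewrite [LHS]conv_diagl /=.
case: eqVneq => // _; last by rewrite mulr0.
by case: insub => [z|]; rewrite ?mulr1 // mulVf // (valP (eps z)).
Qed.

Definition Drho_eps eps (a : Dalg X K) : Dalg X K :=
  (u_eps eps * rho a.1 * u_eps_inv eps,
   conv (conv (u_eps eps) (rho_inc a.2)) (u_eps_inv eps)).

Definition signs : Type := {k : K | (k == 1) || (k == -1)}.

Definition is_sign (Phi : Dalg X K -> Dalg X K) : signs -> Prop :=
  unique (fun k => exists2 Psi, inner_automorphism Psi &
                     Phi =1 Psi \o Drho \o Dk (val k)).

Definition chi (eps : fixed_point -> Kstar K) : fixed_point -> sqr_class K :=
  fun x => sqr_proj (eps x).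

Definition pair_equiv (p q : (fixed_point -> sqr_class K) * signs) : Prop :=
  p.2 = q.2 /\ exists g : sqr_class K, forall x, p.1 x = (g * q.1 x)%g.

Definition pair_class p : set ((fixed_point -> sqr_class K) * signs) :=
  [set q | pair_equiv q p].

(* C is the class induced by Phi: the uniqueness carried by [unique] is the    *)
(* independence of C from the choice of eps.                                   *)
Definition is_induced_class (Phi : Dalg X K -> Dalg X K) :
    set ((fixed_point -> sqr_class K) * signs) -> Prop :=
  unique (fun C => exists k eps,
    [/\ is_sign Phi k, inner_equivalent Phi (Drho_eps eps \o Dk (val k))
      & C = pair_class (chi eps, k)]).

End Rho.

(* Main.v *)
From Pilot Require Import Defs.
From HB Require Import structures.
From mathcomp Require Import all_boot all_order all_algebra.
From mathcomp Require Import boolp classical_sets functions cardinality fsbigop.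
From mathcomp Require Import ring.

Set Implicit Arguments.
Unset Strict Implicit.
Unset Printing Implicit Defensive.

Import Order.TTheory GRing.Theory.
Import Pilot.Defs.

Local Open Scope classical_set_scope.
Local Open Scope ring_scope.

(** Write [R] for the composition of the order-reversing symmetry [Drho] with
    [Dk k]; it is an involution of [D(X, K)] when [k ^+ 2 = 1]. The theorem
    reduces to the classification of symmetric units up to congruence.

    First, every involution [Phi] inducing [lam] is [a |-> U * R a * V] with [U],
    [V] mutually inverse and [k ^+ 2 = 1] ([involution_form]). Indeed
    [th := Phi \o Drho] is an automorphism that preserves the conjugacy class of
    every [e_x], and such automorphisms are inner up to some [Dk k]
    ([cp_structure]): a single unit conjugates all the [th (e_x)] back to the
    [e_x] ([common_conjugation]); the induced automorphism of [FI(X, K)] is then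
    multiplicative, hence inner by hypothesis; what remains on [FI(X, K)] is a
    derivation into [I(X, K)], again inner by hypothesis; and an automorphism
    that is the identity on [FI(X, K)] acts on [I(X, K)] as a bimodule
    endomorphism, that is, as a scalar because [X] is connected. The delicate
    point of [common_conjugation] is that the matrix whose columns come from the
    [th (e_x)] is finitary: this uses that [th] is defined on the idempotents of
    all subsets of [X], together with Zorn's lemma ([finite_independent]).

    Next, since [Phi] is involutive, [R U] is a central multiple of [U], and
    replacing [U] by [U + R U] makes [U] symmetric ([involution_symmetric]); this
    is where the fixed point of [lam] and the characteristic are used.
    Conjugating [Phi] by [W] replaces [U] by [W * U * R W], up to a central unit
    ([congruence_equivalent], [equivalent_congruence]). A symmetric unit of
    [FI(X, K)] is congruent to some [u_eps] ([symmetric_congruence]): a diagonal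
    congruence brings it to the form [u_eps * (1 + m)] with [m] of zero diagonal,
    and [1 + m] has an inverse square root because [m] is locally nilpotent
    ([finc_inv_sqrt]). A further congruence by some [(1, h)] removes the
    component in [I(X, K)], which gives [involution_normal_form].

    Finally the sign is read off the value of [Phi] at [(0, delta)], on which
    inner automorphisms act trivially, and comparing the diagonals of
    [W * U * R W] and [Z * E] with [Z] central at the fixed points of [lam] shows
    that two normal forms of the same sign are equivalent exactly when their
    square classes agree up to a constant ([eps_equivalent],
    [equivalent_eps]). *)

(** * Finiteness criteria *)

(** Stated for an arbitrary strict order, so as to provide both minimal and
    maximal elements. *)
Lemma finite_min (T : eqType) (r : rel T) (A : set T) :
    irreflexive r -> transitive r -> finite_set A -> A !=set0 ->
  exists2 a, A a & forall b, A b -> ~~ r b a.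
Proof.
move=> rI rT /finite_seqP[s ->]; elim: s => [[z //]|z s IHs] _.
have [->|s0] := eqVneq s [::].
  exists z; first by rewrite /= inE eqxx.
  by move=> b /=; rewrite inE => /eqP ->; rewrite rI.
have [|a /= as_ amin] := IHs.
  by case: s s0 {IHs} => // b s _; exists b; rewrite /= mem_head.
have [za|za] := boolP (r z a).
  exists z; first by rewrite /= mem_head.
  move=> b /=; rewrite inE => /predU1P[->|bs]; first by rewrite rI.
  by apply: contraNN (amin b bs) => bz; apply: rT za.
exists a; first by rewrite /= inE as_ orbT.
by move=> b /=; rewrite inE => /predU1P[->|/amin].
Qed.

(** A finite-set criterion: if every point [b] of [S] satisfies [h b != b]
    and every subset [B] of [S] with [h b \notin B] for [b] in [B] is finite,
    then [S] is finite. Zorn's lemma provides a maximal such subset [M]; by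
    maximality, [S] is covered by [M], by the image of [M] under [h] and by the
    fibres of [h] in [S] over the points of [M]. These fibres are themselves
    such subsets, hence finite. *)
Lemma finite_independent (T : Type) (S : set T) (h : T -> T) :
    (forall b, S b -> h b <> b) ->
    (forall B, B `<=` S -> (forall b, B b -> ~ B (h b)) -> finite_set B) ->
  finite_set S.
Proof.
move=> hb fin_indep.
pose indep (B : set T) := B `<=` S /\ forall b, B b -> ~ B (h b).
have [|M [[MS Mh] Mmax]] := @Zorn_bigcup T indep.
  move=> F Findep Ftot; split=> [b [B FB Bb]|b [B FB Bb] [C FC Chb]].
    by have [BS _] := Findep B FB; exact: BS.
  have [BC|CB] := Ftot B C FB FC.
    by have [_ /(_ b (BC _ Bb))] := Findep C FC.
  by have [_ /(_ b Bb)] := Findep B FB; apply; exact: CB.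
have finM : finite_set M by exact: fin_indep.
have fin_fibre c : finite_set [set b | S b /\ h b = c].
  apply: fin_indep => [b []//|b [Sb hbc] [Sc]].
  by rewrite hbc => hcc; apply: hb hcc; rewrite -hbc.
apply: (@sub_finite_set _ _
  (M `|` h @` M `|` \bigcup_(c in M) [set b | S b /\ h b = c])); last first.
  rewrite !finite_setU; split; first by split=> //; exact: finite_image.
  by apply: bigcup_finite.
move=> b Sb; have [Mb|nMb] := pselect (M b); first by left; left.
apply: contrapT => nb; apply: (Mmax (b |` M)).
  split; first by move=> c Mc; right.
  by move=> /(_ b (or_introl erefl)).
split=> [c [->//|/MS//]|c [->|Mc] [hc|Mhc]].
- exact: hb hc.
- by apply: nb; right; exists (h b).
- by apply: nb; left; right; exists c.
- exact: Mh Mc Mhc.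
Qed.

(** * Pointwise computations and elementary functions *)

Section Pointwise.
Context {disp : Order.disp_t} {X : porderType disp} {K : fieldType}.
Implicit Types (f g h : finc X K) (i j : incidence X K) (x y z a b : X).

Lemma convxx i j x : conv i j x x = i x x * j x x.
Proof.
rewrite (convE (S := [set x])) ?fsbig_set1 // => z /=.
rewrite mulf_eq0 negb_or => /andP[/incidence_le xz /incidence_le zx].
by apply/le_anti; rewrite xz zx.
Qed.

Lemma finc_at x y f g : f = g -> f x y = g x y.
Proof. by move->. Qed.

Lemma finc_mulE f g x y : (f * g) x y = conv f g x y.
Proof. by []. Qed.

Lemma finc_mulxx f g x : (f * g) x x = f x x * g x x.
Proof. exact: convxx. Qed.

Lemma finc1E x y : (1 : finc X K) x y = if x == y then 1 else 0.
Proof. by []. Qed.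

Lemma finc1xx x : (1 : finc X K) x x = 1.
Proof. by rewrite finc1E eqxx. Qed.

Lemma fincN f x y : (- f) x y = - f x y. Proof. by []. Qed.
Lemma fincZ c f x y : (c *: f) x y = c * f x y. Proof. by []. Qed.
Lemma finc0 x y : (0 : finc X K) x y = 0. Proof. by []. Qed.

Lemma conv_fN f i : conv f (- i) = - conv f i.
Proof. by rewrite -scaleN1r convZr scaleN1r. Qed.

Lemma unit_diag f g x : f * g = 1 -> f x x != 0.
Proof.
move=> /(finc_at x x); rewrite finc_mulxx finc1xx => fg.
by apply: contra_eq_neq fg => ->; rewrite mul0r eq_sym oner_neq0.
Qed.

Lemma diagM (s t : X -> K) : diag s * diag t = diag (fun x => s x * t x).
Proof.
apply: finc_eq => x y; rewrite finc_mulE conv_diagl /=.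
by case: eqVneq => [->|]; rewrite ?mulr0.
Qed.

Lemma diag1 (t : X -> K) : (forall x, t x = 1) -> diag t = 1.
Proof. by move=> t1; apply: finc_eq => x y; rewrite finc1E /= t1. Qed.

(** The diagonal idempotent supported by a set of points. *)
Definition e_set (B : set X) : finc X K := diag (fun x => (x \in B)%:R).

Lemma e_set1 x : e_set [set x] = e_ x.
Proof.
apply: finc_eq => a b /=; case: eqVneq => // _; congr (_%:R).
by congr nat_of_bool; apply/idP/eqP => [|->]; rewrite ?inE.
Qed.

Lemma e_setM (B : set X) x :
  e_set B * e_ x = if x \in B then e_ x else 0.
Proof.
apply: finc_eq => a b; rewrite /e_set /e_ diagM /=.
transitivity (if x \in B then (e_ x : finc X K) a b else 0); last by case: ifP.
rewrite /=; case: (a =P b) => [_|_]; last by rewrite if_same.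
by case: (a =P x) => [->|_]; case: (x \in B); rewrite ?mulr1 ?mulr0.
Qed.

Lemma e_M x y : e_ x * e_ y = if x == y then e_ x else 0 :> finc X K.
Proof.
rewrite -[e_ x]e_set1 e_setM e_set1 in_set1 eq_sym.
by case: (x =P y) => [->|].
Qed.

(** The elementary function supported by the interval [x, y] (zero unless
    [x <= y]). *)
Fact Eij_subproof x y :
  incidence_pred (fun a b => [&& a == x, b == y & (x <= y)%O]%:R : K).
Proof.
apply/asboolP => a b; case: eqVneq => [->|] //=; case: eqVneq => [->|] //=.
by move=> /negbTE->.
Qed.

Fact Eij_finitary x y : finc_pred (Incidence (Eij_subproof x y)).
Proof.
apply/asboolP => a b _; apply: (@sub_finite_set _ _ [set (x, y)]); last first.
  exact: finite_set1.
move=> [c d] /= [_ _ _]; case: (c =P x) => [->|_]; last by rewrite eqxx.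
by case: (d =P y) => [->|_]; last by rewrite eqxx.
Qed.

Definition Eij x y : finc X K := Finc (Eij_finitary x y).

Lemma Eij_id x y : (x <= y)%O -> Eij x y x y = 1.
Proof. by move=> xy; rewrite /= !eqxx xy. Qed.

Lemma Eijxx x : Eij x x = e_ x.
Proof.
apply: finc_eq => a b /=; rewrite lexx andbT.
case: (a =P x) => [->|_]; last by rewrite if_same.
by rewrite eq_sym; case: (x =P b).
Qed.

Lemma conv_ei x i a b : conv (e_ x) i a b = if a == x then i a b else 0.
Proof. by rewrite conv_diagl; case: eqP; rewrite ?mul1r ?mul0r. Qed.

Lemma conv_ie x i a b : conv i (e_ x) a b = if b == x then i a b else 0.
Proof. by rewrite conv_diagr; case: eqP; rewrite ?mulr1 ?mulr0. Qed.

Lemma conv_eie x i y :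
  conv (conv (e_ x) i) (e_ y) = i x y *: (Eij x y : incidence X K).
Proof.
apply/incidenceP => a b; rewrite conv_ie conv_ei incZ /=.
case: (b =P y) => [->|_]; last by rewrite andbF mulr0.
case: (a =P x) => [->|_]; last by rewrite mulr0.
by case: (boolP (x <= y)%O) => [_|/(incidence0 i) ->]; rewrite ?mulr1 ?mul0r.
Qed.

Lemma finc_efe x f y : e_ x * f * e_ y = f x y *: Eij x y.
Proof. by apply: val_inj; exact: conv_eie. Qed.

Lemma conv_iE i x y a b : (x <= y)%O ->
  conv i (Eij x y) a b = if b == y then i a x else 0.
Proof.
move=> xy; rewrite (convE (S := [set x])); last first.
  by move=> z /=; case: (z =P x) => //= _; rewrite mulr0 eqxx.
by rewrite fsbig_set1 /= eqxx xy andbT /=; case: eqP; rewrite ?mulr1 ?mulr0.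
Qed.

Lemma conv_Ei i x y a b : (x <= y)%O ->
  conv (Eij x y) i a b = if a == x then i y b else 0.
Proof.
move=> xy; rewrite (convE (S := [set y])); last first.
  by move=> z /=; case: (z =P y) => //= _; rewrite andbF mul0r eqxx.
by rewrite fsbig_set1 /= eqxx xy andbT /=; case: eqP; rewrite ?mul1r ?mul0r.
Qed.

Lemma EijM x y z : (x <= y)%O -> (y <= z)%O -> Eij x y * Eij y z = Eij x z.
Proof.
move=> xy yz; apply: finc_eq => a b; rewrite finc_mulE conv_iE //=.
rewrite eqxx xy (le_trans xy yz) !andbT /=.
by case: (b == z); rewrite ?andbF ?andbT.
Qed.

(** An idempotent of [FI(X, K)] whose diagonal is zero vanishes: a minimal
    point [c] of the finite set [{c <= y | f x c != 0}] satisfies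
    [f x c = (f * f) x c = 0]. *)
Lemma idem_diag0 f : f * f = f -> (forall x, f x x = 0) -> f = 0.
Proof.
move=> ff f0; apply: finc_eq => x y; rewrite finc0.
have [//|fxy] := eqVneq (f x y) 0.
have [|c /= [cy fc] cmin] := finite_min lt_irreflexive lt_trans (finc_row f x y).
  by exists y; split.
move: fc; rewrite -ff finc_mulE (convE (S := set0)) ?fsbig_set0 ?eqxx // => z.
rewrite mulf_eq0 negb_or => /andP[fz fzc]; have zc := incidence_le fzc.
have zy : (z <= y)%O := le_trans zc cy.
have := cmin z (conj zy fz); rewrite lt_neqAle zc andbT negbK => /eqP zE.
by rewrite zE f0 eqxx in fzc.
Qed.

End Pointwise.

(** * The common conjugation of a family of idempotents *)

Section Idempotents.
Context {disp : Order.disp_t} {X : porderType disp} {K : fieldType}.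
Implicit Types (f g : finc X K) (x y z a b : X) (B : set X).

Section Column.
Variable phi : finc X K -> finc X K.
Hypothesis phiM : forall f g, phi (f * g) = phi f * phi g.
Hypothesis phi0 : phi 0 = 0.
Hypothesis phi_e : forall x, phi (e_ x) x x = 1.

Lemma phi_eM x y : phi (e_ x) * phi (e_ y) = if x == y then phi (e_ x) else 0.
Proof. by rewrite -phiM e_M; case: eqP; rewrite ?phi0. Qed.

Lemma phi_set_diag B a : phi (e_set B) a a = (a \in B)%:R.
Proof.
have := finc_at a a (phiM (e_set B) (e_ a)).
rewrite finc_mulxx phi_e mulr1 e_setM => <-.
by case: ifP => _; rewrite ?phi_e ?phi0.
Qed.

(** The value at [(a, b)] of the image of [e_set B], when [b] is in [B], [a]
    is not, and [phi (e_ b)] vanishes strictly between [a] and [b]. *)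
Lemma phi_set_off B a b : (a < b)%O -> b \in B -> a \notin B ->
    (forall c, (a < c < b)%O -> phi (e_ b) c b = 0) ->
  phi (e_set B) a b = phi (e_ b) a b.
Proof.
move=> ab bB aB pb0.
have := finc_at a b (phiM (e_set B) (e_ b)).
rewrite e_setM bB => ->.
rewrite finc_mulE (convE (S := [set a] `|` [set b])) => [|z].
  rewrite fsbigU0 ?fsbig_set1; first last.
  - by move=> z [/= -> ba]; rewrite ba ltxx in ab.
  - exact: finite_set1.
  - exact: finite_set1.
  by rewrite phi_set_diag (negbTE aB) phi_e mul0r mulr1 /= add0r.
rewrite mulf_eq0 negb_or => /andP[/incidence_le az pz].
have zb := incidence_le pz.
have [->|za] := eqVneq z a; first by left.
have [->|zb'] := eqVneq z b; first by right.
by rewrite pb0 ?eqxx // in pz; rewrite !lt_neqAle zb az zb' eq_sym za.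
Qed.

Fact phi_column_subproof : incidence_pred (fun x y => phi (e_ y) x y).
Proof. by apply/asboolP => x y /incidence0 ->. Qed.

(** The columns of the [phi (e_ y)] assemble into a finitary function: let [S]
    be the set of the [b] whose column has a nonzero off-diagonal value in
    [[x, y]], and let [h b] be a maximal [a] with [phi (e_ b) a b != 0]. If [B]
    is a subset of [S] with [h b \notin B] for [b] in [B], then
    [phi (e_set B)] is nonzero at every [(h b, b)] with [b] in [B], so that [B]
    is finite. *)
Lemma phi_column_finitary : finc_pred (Incidence phi_column_subproof).
Proof.
apply/asboolP => x y xy.
pose nz b := [set a | [/\ (x <= a)%O, (a < b)%O & phi (e_ b) a b != 0]].
have fin_nz b : finite_set (nz b).
  by apply: sub_finite_set (finc_col (phi (e_ b)) x b) => a [].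
pose S := [set b | (b <= y)%O /\ nz b !=set0].
have /choice[h hP] b : exists a, S b -> nz b a /\ forall c, nz b c -> ~~ (a < c)%O.
  have [[_ nzb]|?] := pselect (S b); last by exists b.
  have [||a aS amax] := finite_min (r := fun u v => (v < u)%O) _ _ (fin_nz b) nzb.
  - exact: lt_irreflexive.
  - by move=> u v w vu uw; exact: lt_trans uw vu.
  by exists a.
have finS : finite_set S.
  apply: (@finite_independent _ S h) => [b /hP[[_ + _] _] hb|B BS Bh].
    by rewrite hb ltxx.
  apply: sub_finite_set (finite_image snd (fincP (phi (e_set B)) xy)) => b Bb.
  have Sb := BS _ Bb; have [[xh hb phb] hmax] := hP b Sb.
  exists (h b, b) => //=; split=> //=; first by case: Sb.
  rewrite phi_set_off ?inE //; first by apply/negP; rewrite inE; exact: Bh.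
  move=> c /andP[hc cb]; have [//|pc] := eqVneq (phi (e_ b) c b) 0.
  have := hmax c; rewrite hc; case/(_ _)/negP; split=> //.
  exact: le_trans xh (ltW hc).
apply: (@sub_finite_set _ _ (\bigcup_(b in S) ((fun a => (a, b)) @` nz b))).
  move=> [a b] /= [xa ab yb pab]; exists b; last by exists a.
  by split=> //; exists a.
by apply: bigcup_finite => // b _; exact: finite_image.
Qed.

(** The function whose [y]-th column is that of [phi (e_ y)]. *)
Definition phi_column : finc X K := Finc phi_column_finitary.

Lemma phi_columnE x y : phi_column x y = phi (e_ y) x y. Proof. by []. Qed.

Lemma phi_column_conj x : phi (e_ x) * phi_column = phi_column * e_ x.
Proof.
apply: finc_eq => a b; rewrite !finc_mulE conv_ie phi_columnE.
transitivity ((phi (e_ x) * phi (e_ b)) a b).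
  rewrite finc_mulE; apply: eq_fsbigr => z _; congr (_ * _).
by rewrite phi_eM eq_sym; case: eqP => [->|].
Qed.

End Column.
End Idempotents.

(** * The anti-automorphism defined by an involution of the poset *)

Section RhoTheory.
Context {disp : Order.disp_t} {X : porderType disp} {K : fieldType}.
Variables (lam : X -> X) (lamP : poset_involution lam).
Implicit Types (f g u v : finc X K) (i j : incidence X K) (x y z : X).

Local Notation rho := (rho lamP (K := K)).
Local Notation rhoi := (rho_inc lamP (K := K)).

Lemma lamK : involutive lam. Proof. by case: lamP. Qed.
Lemma lam_le x y : (lam x <= lam y)%O = (y <= x)%O.
Proof. by case: lamP => -> _; rewrite -!(proj1 lamP). Qed.

Lemma rho_inc_conv i j : rhoi (conv i j) = conv (rhoi j) (rhoi i).
Proof.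
apply/incidenceP => x y; rewrite /= /conv_fun.
rewrite (reindex_fsbig lam [set z | (x <= z <= y)%O]); last first.
  split.
  - by move=> z /= /andP[xz zy]; rewrite !lam_le xz zy.
  - by move=> z w _ _; apply: (can_inj lamK).
  - move=> z /= /andP[xz zy]; exists (lam z); last by rewrite lamK.
    by rewrite /= -(lamK x) -(lamK y) !lam_le xz zy.
by apply: eq_fsbigr => z _; rewrite mulrC.
Qed.

Lemma rhoM f g : rho (f * g) = rho g * rho f.
Proof. by apply: val_inj; exact: rho_inc_conv. Qed.

Lemma rho_incK : involutive rhoi.
Proof. by move=> i; apply/incidenceP => x y /=; rewrite !lamK. Qed.

Lemma rhoK : involutive rho.
Proof. by move=> f; apply: finc_eq => x y /=; rewrite !lamK. Qed.

Lemma rho_diag (t : X -> K) : rho (diag t) = diag (fun x => t (lam x)).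
Proof.
apply: finc_eq => x y /=; rewrite (inj_eq (can_inj lamK)) eq_sym.
by case: (x =P y) => [->|].
Qed.

Lemma rho1 : rho 1 = 1.
Proof. exact: rho_diag. Qed.

Lemma rho_e x : rho (e_ x) = e_ (lam x).
Proof.
rewrite /e_ rho_diag; congr diag; apply/funext => a.
by rewrite -[in RHS](lamK a) (inj_eq (can_inj lamK)).
Qed.

Lemma rho0 : rho 0 = 0.
Proof. exact: finc_eq. Qed.

(** A multiplicative map [phi] under which every [phi (e_ x)] has value [1] at
    [(x, x)] is conjugate, on all the [e_ x] simultaneously, to the identity. *)
Lemma common_conjugation (phi : finc X K -> finc X K) :
    (forall f g, phi (f * g) = phi f * phi g) -> phi 0 = 0 ->
    (forall x, phi (e_ x) x x = 1) ->
  exists u v, [/\ u * v = 1, v * u = 1 & forall x, phi (e_ x) * u = u * e_ x].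
Proof.
move=> phiM phi0 phi_e.
pose u := phi_column phiM phi0 phi_e.
pose phi' f := rho (phi (rho f)).
have phi'M f g : phi' (f * g) = phi' f * phi' g by rewrite /phi' rhoM phiM rhoM.
have phi'0 : phi' 0 = 0 by rewrite /phi' rho0 phi0 rho0.
have phi'_e x : phi' (e_ x) x x = 1 by rewrite /phi' rho_e /= phi_e.
(* The x-th row of [v] is that of [phi (e_ x)]; that [v] is finitary follows
   from the statement on columns by duality. *)
pose v := rho (phi_column phi'M phi'0 phi'_e).
have vE x y : v x y = phi (e_ x) x y by rewrite /= /phi' rho_e /= !lamK.
have vu : v * u = 1.
  apply: finc_eq => x y; transitivity ((phi (e_ x) * phi (e_ y)) x y).
    by rewrite !finc_mulE; apply: eq_fsbigr => z _; rewrite vE.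
  by rewrite phi_eM // finc1E; case: eqP => [<-|_]; rewrite ?phi_e.
exists u, v; split=> //; last by move=> x; exact: phi_column_conj.
(* [1 - u * v] is an idempotent with zero diagonal. *)
apply/eqP; rewrite eq_sym -subr_eq0; apply/eqP/idem_diag0 => [|x].
  by rewrite mulrBr mulr1 mulrBl mul1r mulrA -(mulrA u) vu mulr1 subrr subr0.
rewrite fincDE fincN finc_mulxx finc1xx vE phi_e mulr1 /=.
by rewrite phi_e subrr.
Qed.

End RhoTheory.

(** * The algebra D(X, K) *)

Section LinearMaps.
Context (K : fieldType) (U V : lmodType K) (f : U -> V).
Hypothesis f_lin : linear f.

Lemma lin0 : f 0 = 0.
Proof.
have := f_lin (-1) 0 0; rewrite scaler0 addr0 scaleN1r => ->.
by rewrite addNr.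
Qed.

Lemma linD a b : f (a + b) = f a + f b.
Proof. by have := f_lin 1 a b; rewrite !scale1r. Qed.

Lemma linZ c a : f (c *: a) = c *: f a.
Proof. by have := f_lin c a 0; rewrite !addr0 lin0 addr0. Qed.

End LinearMaps.

Section DTheory.
Context {disp : Order.disp_t} {X : porderType disp} {K : fieldType}.
Implicit Types (f g u v : finc X K) (i j : incidence X K) (x y z : X).
Implicit Types (a b : Dalg X K).

(** The two summands of [D(X, K)]: the subalgebra [FI(X, K)] and the square-zero
    ideal [I(X, K)]. *)
Definition inD f : Dalg X K := (f, 0).
Definition inN i : Dalg X K := (0, i).

Lemma conv0f i : conv (0 : finc X K) i = 0.
Proof. by rewrite -[0 in LHS](scale0r (0 : finc X K)) convZl scale0r. Qed.

Lemma convf0 i : conv i (0 : finc X K) = 0.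
Proof. by rewrite -[0 in LHS](scale0r (0 : finc X K)) convZr scale0r. Qed.

Lemma conv1f i : conv (1 : finc X K) i = i. Proof. exact: conv_1l. Qed.
Lemma convf1 i : conv i (1 : finc X K) = i. Proof. exact: conv_1r. Qed.

Lemma inDM f g : inD (f * g) = inD f * inD g.
Proof. by congr pair; rewrite /= conv_f0 conv_0f addr0. Qed.

Lemma inDN f i : inD f * inN i = inN (conv f i).
Proof. by congr pair; rewrite /= ?mulr0 // convf0 addr0. Qed.

Lemma inND f i : inN i * inD f = inN (conv i f).
Proof. by congr pair; rewrite /= ?mul0r // conv0f add0r. Qed.

Lemma inNN i j : inN i * inN j = 0.
Proof. by congr pair; rewrite /= ?mul0r // conv0f convf0 addr0. Qed.

Lemma Dsplit a : a = inD a.1 + inN a.2.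
Proof. by case: a => f i; congr pair; rewrite /= ?addr0 ?add0r. Qed.

Lemma inD_lin : linear inD.
Proof. by move=> c f g; congr pair; rewrite /= scaler0 addr0. Qed.

Lemma inN_lin : linear inN.
Proof. by move=> c f g; congr pair; rewrite /= scaler0 addr0. Qed.

Lemma DfstM a b : (a * b).1 = a.1 * b.1. Proof. by []. Qed.
Lemma DsndM a b : (a * b).2 = conv a.1 b.2 + conv a.2 b.1. Proof. by []. Qed.
Lemma Dsnd_lin c a b : (c *: a + b).2 = c *: a.2 + b.2. Proof. by []. Qed.
Lemma D_eq a b : a.1 = b.1 -> a.2 = b.2 -> a = b.
Proof. by case: a b => [? ?] [? ?] /= -> ->. Qed.

Lemma inDK f g : f * g = 1 -> inD f * inD g = 1.
Proof. by rewrite -inDM => ->. Qed.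

Lemma conv_sc1 c i : conv (c *: (1 : finc X K)) i = c *: i.
Proof. by rewrite [LHS]convZl conv1f. Qed.
Lemma conv_1sc c i : conv i (c *: (1 : finc X K)) = c *: i.
Proof. by rewrite [LHS]convZr convf1. Qed.

Lemma Dconj_lin (A B : Dalg X K) (th : Dalg X K -> Dalg X K) :
  linear th -> linear (fun a => A * th a * B).
Proof.
move=> th_lin c a b; rewrite th_lin mulrDr mulrDl; congr (_ + _).
by rewrite -Dalg_scaleAr -Dalg_scaleAl.
Qed.

Lemma Dconj_mul (A B : Dalg X K) (th : Dalg X K -> Dalg X K) : B * A = 1 ->
    (forall a b, th (a * b) = th a * th b) ->
  forall a b, A * th (a * b) * B = (A * th a * B) * (A * th b * B).
Proof.
by move=> BA thM a b; rewrite thM !mulrA -(mulrA _ B A) BA mulr1.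
Qed.

(** The elements [(c, j)] with [c] a nonzero scalar are units. *)
Lemma D_scalar_unit (c : K) j : c != 0 ->
  let a : Dalg X K := (c *: (1 : finc X K), j) in
  exists b, a * b = 1 /\ b * a = 1.
Proof.
move=> c0 a; exists (c^-1 *: (1 : finc X K), - c^-2 *: j).
have cc : c * - c^-2 + c^-1 = 0.
  by rewrite expr2 invfM mulrN mulrA mulfV // mul1r addNr.
split; apply: D_eq.
- by rewrite DfstM -finc_scaleAl mul1r scalerA mulfV // scale1r.
- by rewrite DsndM conv_sc1 conv_1sc scalerA -scalerDl cc scale0r.
- by rewrite DfstM -finc_scaleAl mul1r scalerA mulVf // scale1r.
- by rewrite DsndM conv_sc1 conv_1sc scalerA -scalerDl addrC cc scale0r.
Qed.

Lemma connected_const (T : Type) (c : X -> T) : poset_connected X ->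
  (forall x y, (x <= y)%O -> c x = c y) -> forall x y, c x = c y.
Proof.
move=> X_conn cle x y; have [s [+ <-]] := X_conn x y.
elim: s x => //= z s IHs x /andP[/orP[xz|xz] /IHs <-]; first exact: cle.
by rewrite (cle z x).
Qed.

(** The centre of [FI(X, K)] consists of scalars. *)
Lemma finc_center (x0 : X) (z : finc X K) : poset_connected X ->
  (forall f, z * f = f * z) -> z = z x0 x0 *: (1 : finc X K).
Proof.
move=> X_conn zC.
have zE x y : (x <= y)%O -> z x x = z y y.
  move=> xy; have := finc_at x y (zC (Eij x y)).
  by rewrite !finc_mulE conv_iE // conv_Ei // !eqxx.
have zdiag x y : x != y -> z x y = 0.
  move=> xy; have := finc_at x y (zC (e_ x)).
  by rewrite !finc_mulE conv_ei conv_ie eqxx eq_sym (negbTE xy).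
apply: finc_eq => x y; rewrite fincZ finc1E.
have [->|/zdiag ->] := eqVneq x y; last by rewrite mulr0.
by rewrite mulr1; apply: (connected_const X_conn (c := fun w => z w w)).
Qed.

End DTheory.

(** * Automorphisms preserving the classes of the primitive idempotents *)

Section Endomorphisms.
Context {disp : Order.disp_t} {X : porderType disp} {K : fieldType}.
Variables (lam : X -> X) (lamP : poset_involution lam).
Implicit Types (f g u v : finc X K) (i j : incidence X K) (x y z : X).
Implicit Types (a b : Dalg X K) (th : Dalg X K -> Dalg X K).

(** Algebra endomorphisms of [D(X, K)] that preserve the conjugacy class of
    each [e_x]. *)
Definition class_preserving th : Prop :=
  [/\ linear th, forall a b, th (a * b) = th a * th b
    & forall x, conjugate (th (inD (e_ x))) (inD (e_ x))].

Lemma conjugate_diag a b x : conjugate a b -> a.1 x x = b.1 x x.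
Proof.
move=> [u [v [uv _ ->]]]; rewrite !DfstM !finc_mulxx mulrAC -finc_mulxx -DfstM uv.
by rewrite [_.1]/= finc1xx mul1r.
Qed.

Lemma cp_conjugation th : class_preserving th ->
  exists u v, [/\ u * v = 1, v * u = 1
    & forall x, v * (th (inD (e_ x))).1 * u = e_ x].
Proof.
move=> [th_lin thM th_e].
have [||x|u [v [uv vu pu]]] :=
  common_conjugation lamP (phi := fun f => (th (inD f)).1).
- by move=> f g; rewrite inDM thM.
- by rewrite (_ : inD 0 = 0) // lin0.
- by rewrite (conjugate_diag _ (th_e x)) /= !eqxx.
by exists u, v; split=> // x; rewrite -mulrA pu mulrA vu mul1r.
Qed.

(** Such an endomorphism maps the ideal [I(X, K)] into itself. The image of
    [(0, e_x)] has square zero, so that its component in [FI(X, K)] is, up to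
    conjugation, a multiple of [e_x] of square zero, that is, [0]; and every
    [e_x i e_y] is a multiple of [e_x] in the bimodule [I(X, K)]. *)
Lemma cp_ideal th i : class_preserving th -> (th (inN i)).1 = 0.
Proof.
move=> th_cp; have [u [v [uv vu pu]]] := cp_conjugation th_cp.
have [th_lin thM _] := th_cp.
pose al j := v * (th (inN j)).1 * u.
have alDM f j : al (conv f j) = (v * (th (inD f)).1 * u) * al j.
  by rewrite /al -inDN thM DfstM !mulrA -(mulrA _ u v) uv mulr1.
have alMD f j : al (conv j f) = al j * (v * (th (inD f)).1 * u).
  by rewrite /al -inND thM DfstM !mulrA -(mulrA _ u v) uv mulr1.
have alL x j : al (conv (e_ x) j) = e_ x * al j by rewrite alDM pu.
have alR x j : al (conv j (e_ x)) = al j * e_ x by rewrite alMD pu.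
have ale x : al (e_ x) = 0.
  have eae : al (e_ x) = al (e_ x) x x *: e_ x.
    have := finc_efe x (al (e_ x)) x; rewrite Eijxx => <-.
    rewrite -alL -alR; congr al.
    by rewrite -[RHS]/(finc_inc (e_ x * e_ x * e_ x)) !e_M eqxx e_M eqxx.
  have al2 : al (e_ x) * al (e_ x) = 0.
    rewrite /al -mulrA 2!(mulrA u) uv mul1r -mulrA (mulrA _ _ u) -DfstM -thM.
    by rewrite inNN (lin0 th_lin) mul0r mulr0.
  have := finc_at x x al2; rewrite finc_mulxx => /eqP.
  by rewrite mulf_eq0 orbb => /eqP ae0; rewrite eae ae0 scale0r.
have ali : al i = 0.
  apply: finc_eq => x y.
  have [xy|/incidence0 ->//] := boolP (x <= y)%O.
  have := finc_at x y (finc_efe x (al i) y); rewrite fincZ Eij_id // mulr1 => <-.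
  rewrite -alL -alR conv_eie.
  rewrite (_ : _ *: _ = conv (e_ x) (i x y *: Eij x y : finc X K)).
    by rewrite alMD ale mul0r.
  apply/incidenceP => a b; rewrite conv_ei incZ /=.
  by case: (a == x); rewrite ?mulr0.
have <- : u * al i * v = (th (inN i)).1.
  by rewrite /al !mulrA uv mul1r -mulrA uv mulr1.
by rewrite ali mulr0 mul0r.
Qed.

Hypothesis X_conn : poset_connected X.
Hypothesis mult_inner : forall s : incidence X K, multiplicative s ->
  inner_automorphism (mult_aut s).
Hypothesis der_inner : forall Der : finc X K -> incidence X K,
  derivation Der -> inner_derivation Der.
Variable x0 : X.

(** On the quotient [FI(X, K)] of [D(X, K)] by [I(X, K)], an invertible
    class-preserving endomorphism is inner: after conjugation it fixes every
    [e_x], hence is multiplicative. Invertibility only serves to show that the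
    scalars by which it multiplies the elementary functions are nonzero. *)
Lemma cp_fst_inner th th' : class_preserving th -> class_preserving th' ->
    cancel th th' ->
  exists u v, [/\ u * v = 1, v * u = 1 & forall f, (th (inD f)).1 = u * f * v].
Proof.
move=> th_cp th'_cp thK; have [u [v [uv vu pu]]] := cp_conjugation th_cp.
have [th_lin thM _] := th_cp.
pose phi f := v * (th (inD f)).1 * u.
have phiM f g : phi (f * g) = phi f * phi g.
  by rewrite /phi inDM thM DfstM !mulrA -(mulrA _ u v) uv mulr1.
have phiZ c f : phi (c *: f) = c *: phi f.
  rewrite /phi (_ : inD (c *: f) = c *: inD f); last exact: (linZ inD_lin).
  by rewrite (linZ th_lin) [(c *: _).1]/= -finc_scaleAr -finc_scaleAl.
have phi_e x : phi (e_ x) = e_ x by exact: pu.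
have phi_inj f : phi f = 0 -> f = 0.
  move=> pf0; have f0 : (th (inD f)).1 = 0.
    have <- : u * phi f * v = (th (inD f)).1.
      by rewrite /phi !mulrA uv mul1r -mulrA uv mulr1.
    by rewrite pf0 mulr0 mul0r.
  have := thK (inD f); rewrite [th (inD f)]Dsplit f0.
  rewrite (_ : inD 0 = 0) // add0r => /(congr1 fst).
  by rewrite cp_ideal.
have phiE f x y : phi f x y = f x y * phi (Eij x y) x y.
  have [xy|nxy] := boolP (x <= y)%O; last by rewrite !incidence0 // mul0r.
  have := finc_at x y (finc_efe x (phi f) y).
  rewrite fincZ Eij_id // mulr1 => <-.
  have <- : phi (e_ x * f * e_ y) = e_ x * phi f * e_ y by rewrite !phiM !phi_e.
  by rewrite finc_efe phiZ fincZ.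
have s_sub : incidence_pred (fun x y => phi (Eij x y) x y).
  by apply/asboolP => x y xy; rewrite incidence0.
pose s : incidence X K := Incidence s_sub.
have phi_Eij x y : phi (Eij x y) = s x y *: Eij x y.
  apply: finc_eq => a b; rewrite phiE fincZ /=.
  case: (a =P x) => [->|_]; last by rewrite mul0r mulr0.
  case: (b =P y) => [->|_]; last by rewrite mul0r mulr0.
  exact: mulrC.
have phi_s f : phi f = mult_aut s f.
  by apply: finc_eq => x y; rewrite phiE mulrC.
have s_mult : multiplicative s.
  split=> [x y xy|x y z xy yz].
    apply/eqP => sxy0; have /phi_inj/(finc_at x y) : phi (Eij x y) = 0.
      by rewrite phi_Eij sxy0 scale0r.
    by rewrite Eij_id // finc0 => /eqP; rewrite oner_eq0.
  have := finc_at x z (phiM (Eij x y) (Eij y z)).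
  rewrite EijM // !phi_Eij -finc_scaleAl -finc_scaleAr EijM // !fincZ.
  by rewrite Eij_id ?(le_trans xy yz) // !mulr1.
have [w [w' [ww' w'w phiw]]] := mult_inner s_mult.
exists (u * w), (w' * v); split=> [||f].
- by rewrite mulrA -(mulrA u) ww' mulr1.
- by rewrite mulrA -(mulrA w') vu mulr1.
rewrite mulrA -(mulrA u w f) -(mulrA u) -phiw -phi_s /phi.
by rewrite !mulrA uv mul1r -mulrA uv mulr1.
Qed.

(** An [FI(X, K)]-bimodule endomorphism of [I(X, K)] is a scalar: it is
    determined by its values on the [e_x], and the scalars at [x <= y] agree
    because both [e_x] and [e_y] generate the elementary function at [(x, y)]. *)
Lemma bimodule_scalar (tau : incidence X K -> incidence X K) :
    linear tau ->
    (forall f i, tau (conv f i) = conv f (tau i)) ->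
    (forall f i, tau (conv i f) = conv (tau i) f) ->
  exists k, forall i, tau i = k *: i.
Proof.
move=> tau_lin tauL tauR; pose c x := tau (e_ x) x x.
have tauE x y : (x <= y)%O -> tau (Eij x y) x y = c x /\ tau (Eij x y) x y = c y.
  move=> xy; split.
    have -> : Eij x y = conv (e_ x) (Eij x y) :> incidence X K.
      by apply/incidenceP => a b; rewrite conv_ei /=; case: (a == x).
    by rewrite tauR conv_iE // eqxx.
  have -> : Eij x y = conv (Eij x y) (e_ y) :> incidence X K.
    apply/incidenceP => a b; rewrite conv_ie /=.
    by case: (b == y) => //; rewrite andbF.
  by rewrite tauL conv_Ei // eqxx.
exists (c x0) => i; apply/incidenceP => x y; rewrite incZ.
have [xy|nxy] := boolP (x <= y)%O; last by rewrite !incidence0 // mulr0.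
have : conv (conv (e_ x) (tau i)) (e_ y) x y = tau i x y.
  by rewrite conv_ie conv_ei !eqxx.
rewrite -tauL -tauR conv_eie (linZ tau_lin) incZ => <-.
rewrite (proj1 (tauE x y xy)) mulrC; congr (_ * _).
apply: (connected_const X_conn) => a b ab.
by have [<- <-] := tauE a b ab.
Qed.

(** A class-preserving endomorphism of [D(X, K)] with a class-preserving left
    inverse is the composition of an inner automorphism and of some [Dk k]. *)
Lemma cp_structure th th' : class_preserving th -> class_preserving th' ->
    cancel th th' ->
  exists U V k, [/\ U * V = 1, V * U = 1 & forall a, th a = U * Dk k a * V].
Proof.
move=> th_cp th'_cp thK; have [th_lin thM _] := th_cp.
have [u [v [uv vu thu]]] := cp_fst_inner th_cp th'_cp thK.
pose th2 a := inD v * th a * inD u.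
have th2_lin : linear th2 by exact: Dconj_lin.
have th2M : forall a b, th2 (a * b) = th2 a * th2 b.
  by apply: Dconj_mul => //; exact: inDK.
have th2_fst f : (th2 (inD f)).1 = f.
  by rewrite !DfstM thu !mulrA vu mul1r -mulrA vu mulr1.
have th2_ideal i : (th2 (inN i)).1 = 0.
  by rewrite !DfstM cp_ideal // mulr0 mul0r.
have th2E a : th2 a = inD v * th a * inD u by [].
clearbody th2.
have [|i Deri] := @der_inner (fun f => (th2 (inD f)).2).
  split=> [c f g|f g]; first by rewrite inD_lin th2_lin Dsnd_lin.
  by rewrite inDM th2M DsndM !th2_fst addrC.
(* Conjugation by [(1, i)] kills the inner derivation. *)
pose N c : Dalg X K := (1, c *: i).
have NN c d : N c * N d = N (c + d).
  apply: D_eq; rewrite ?DfstM ?mulr1 // DsndM conv1f convf1.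
  by rewrite -scalerDl addrC.
have N0 : N 0 = 1 by rewrite /N scale0r.
pose th3 a := N 1 * th2 a * N (-1).
have th3_lin : linear th3 by exact: Dconj_lin.
have th3M : forall a b, th3 (a * b) = th3 a * th3 b.
  by apply: Dconj_mul => //; rewrite NN addNr.
have th3D f : th3 (inD f) = inD f.
  apply: D_eq; first by rewrite !DfstM th2_fst mul1r mulr1.
  rewrite !DsndM !DfstM th2_fst mul1r Deri conv1f convf1.
  rewrite -[(N _).2]/(-1 *: i) -[(N 1).2]/(1 *: i) scale1r scaleN1r.
  by rewrite conv_fN subrK addNr.
have th3N j : th3 (inN j) = inN (th3 (inN j)).2.
  by apply: D_eq => //; rewrite !DfstM th2_ideal mulr0 mul0r.
have [|f j|f j|k th3k] := @bimodule_scalar (fun j => (th3 (inN j)).2).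
- by move=> c j1 j2; rewrite inN_lin th3_lin.
- by rewrite -inDN th3M th3D th3N inDN.
- by rewrite -inND th3M th3D th3N inND.
have uvD := inDK uv; have vuD := inDK vu.
exists (inD u * N (-1)), (N 1 * inD v), k; split=> [||a].
- by rewrite mulrA -(mulrA _ (N (-1))) NN addNr N0 mulr1 uvD.
- by rewrite mulrA -(mulrA _ (inD v)) vuD mulr1 NN subrr.
have <- : th3 a = Dk k a.
  rewrite [a in LHS]Dsplit (linD th3_lin) th3D th3N th3k.
  by apply: D_eq; rewrite /= ?addr0 ?add0r.
rewrite /th3 th2E !mulrA.
do 2!rewrite -(mulrA _ (N (-1)) (N 1)) NN addNr N0 mulr1.
by rewrite uvD mul1r -mulrA uvD mulr1.
Qed.

End Endomorphisms.

(** * Inner equivalence and congruence *)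

Section InnerEquivalence.
Variable A : pzRingType.
Implicit Types (Phi : A -> A) (U V W E F Z : A).

Lemma inner_equivalent_sym Phi Phi' :
  inner_equivalent Phi Phi' -> inner_equivalent Phi' Phi.
Proof.
move=> [Psi [u [v [uv vu PsiE]]] eq_Psi].
exists (fun a => v * a * u); first by exists v, u.
have PsiK a : v * Psi a * u = a by rewrite PsiE !mulrA vu mul1r -mulrA vu mulr1.
have KPsi a : Psi (v * a * u) = a by rewrite PsiE !mulrA uv mul1r -mulrA uv mulr1.
by move=> a /=; rewrite -{1}(KPsi a) -[Phi' _]/((Phi' \o Psi) _) -eq_Psi /= PsiK.
Qed.

Lemma inner_equivalent_trans Phi1 Phi2 Phi3 : inner_equivalent Phi1 Phi2 ->
  inner_equivalent Phi2 Phi3 -> inner_equivalent Phi1 Phi3.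
Proof.
move=> [Psi [u [v [uv vu PsiE]]] eq1] [Psi' [u' [v' [uv' vu' PsiE']]] eq2].
exists (Psi' \o Psi).
  exists (u' * u), (v * v'); split=> [||a].
  - by rewrite mulrA -(mulrA u') uv mulr1.
  - by rewrite mulrA -(mulrA v) vu' mulr1.
  - by rewrite /= PsiE PsiE' !mulrA.
by move=> a /=; rewrite [Psi (Phi1 a)]eq1 [LHS]eq2.
Qed.

(** In what follows [R] is multiplicative for the opposite product, and [Phi],
    [Phi'] are its compositions with the conjugations by [U] and [E], of inverses
    [V] and [F]. *)
Section Congruence.
Variable R : A -> A.
Hypothesis RM : forall a b, R (a * b) = R b * R a.
Hypothesis R1 : R 1 = 1.
Variables (Phi Phi' : A -> A) (U V E F : A).
Hypothesis VU : V * U = 1.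
Hypothesis EF : E * F = 1.
Hypothesis FE : F * E = 1.
Hypothesis PhiE : forall a, Phi a = U * R a * V.
Hypothesis Phi'E : forall a, Phi' a = E * R a * F.

(** Conjugating [Phi] by [W] replaces [U] by [W * U * R W], and central factors
    are immaterial. *)
Lemma congruence_equivalent W W' Z Z' : W * W' = 1 -> W' * W = 1 ->
    Z * Z' = 1 -> (forall a, Z * a = a * Z) -> W * U * R W = Z * E ->
  inner_equivalent Phi Phi'.
Proof.
move=> WW W'W ZZ ZC WUW; exists (fun a => W * a * W'); first by exists W, W'.
have RWW : R W * R W' = 1 by rewrite -RM W'W.
have RW'W : R W' * R W = 1 by rewrite -RM WW.
have WU : W * U = Z * E * R W' by rewrite -WUW -mulrA RWW mulr1.
have VW : V * W' = R W * F * Z'.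
  have inv : Z * E * R W' * (R W * F * Z') = 1.
    by rewrite !mulrA -(mulrA _ (R W')) RW'W mulr1 -(mulrA Z) EF mulr1.
  by rewrite -[LHS]mulr1 -inv -WU !mulrA -(mulrA V) W'W mulr1 VU mul1r.
move=> a /=; rewrite PhiE Phi'E !RM 2!mulrA WU -!mulrA VW !mulrA.
by rewrite -!(mulrA Z) ZC -[LHS]mulrA -ZC ZZ mulr1.
Qed.

Lemma equivalent_congruence : involutive R -> inner_equivalent Phi Phi' ->
  exists W W' Z, [/\ W * W' = 1, W' * W = 1, forall a, Z * a = a * Z
    & W * U * R W = Z * E].
Proof.
move=> RK [Psi [W [W' [WW W'W PsiE]]] eqPsi].
have RWW : R W * R W' = 1 by rewrite -RM W'W.
have RW'W : R W' * R W = 1 by rewrite -RM WW.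
exists W, W', (W * U * R W * F); split=> //; last by rewrite -[RHS]mulrA FE mulr1.
have key b : W * U * b * (V * W') = E * R W' * b * (R W * F).
  have := eqPsi (R b); rewrite /= !PsiE PhiE Phi'E RK !RM RK.
  by rewrite !mulrA.
move=> c; have := key (R W * F * c * E * R W').
have -> : E * R W' * (R W * F * c * E * R W') * (R W * F) = c.
  rewrite !mulrA -(mulrA E) RW'W mulr1 EF mul1r.
  by rewrite -(mulrA _ _ (R W)) RW'W mulr1 -mulrA EF mulr1.
move=> {2}<-; rewrite !mulrA -(mulrA _ W' W) W'W mulr1 -(mulrA _ V U) VU mulr1.
by rewrite -(mulrA _ (R W')) RW'W mulr1 -(mulrA _ E) EF mulr1.
Qed.

(** If [Phi] is involutive then [R U = T * U] with [T] central. *)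
Lemma involution_twist : involutive R -> involutive Phi ->
  exists T, (forall a, T * a = a * T) /\ R U = T * U.
Proof.
move=> RK PhiK; exists (R U * V); split; last by rewrite -mulrA VU mulr1.
have RVU : R U * R V = 1 by rewrite -RM VU.
move=> a; rewrite -{1}(PhiK a) !PhiE !RM RK !mulrA.
by rewrite -(mulrA _ V U) VU mulr1 RVU mul1r.
Qed.

End Congruence.
End InnerEquivalence.

(** * Involutions of D(X, K) *)

Section Involutions.
Context {disp : Order.disp_t} {X : porderType disp} {K : fieldType}.
Variables (lam : X -> X) (lamP : poset_involution lam).
Implicit Types (f g u v : finc X K) (i j : incidence X K) (x y z : X).
Implicit Types (a b U V : Dalg X K) (k : K) (Phi : Dalg X K -> Dalg X K).

Local Notation rho := (rho lamP (K := K)).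
Local Notation rhoi := (rho_inc lamP (K := K)).

(** The anti-automorphism through which every involution inducing [lam] with
    sign [k] factors. *)
Definition Drk k a : Dalg X K := Drho lamP (Dk k a).

Lemma DkM k a b : Dk k (a * b) = Dk k a * Dk k b.
Proof.
by apply: D_eq; rewrite // /Dk /= scalerDr -convZr -convZl.
Qed.

Lemma DrhoM a b : Drho lamP (a * b) = Drho lamP b * Drho lamP a.
Proof.
apply: D_eq; first exact: rhoM.
by rewrite DsndM addrC -!rho_inc_conv; apply/incidenceP.
Qed.

Lemma Drho_lin : linear (Drho lamP (K := K)).
Proof. by move=> c a b; apply: D_eq; [exact: finc_eq|exact/incidenceP]. Qed.

Lemma DrhoK : involutive (Drho lamP (K := K)).
Proof. by move=> a; apply: D_eq; [exact: rhoK|exact: rho_incK]. Qed.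

Lemma Drho_inD f : Drho lamP (inD f) = inD (rho f).
Proof. by apply: D_eq => //; apply/incidenceP. Qed.

Lemma DrkM k a b : Drk k (a * b) = Drk k b * Drk k a.
Proof. by rewrite /Drk DkM DrhoM. Qed.

Lemma Drk_inD k f : Drk k (inD f) = inD (rho f).
Proof. by rewrite /Drk /Dk /= scaler0 Drho_inD. Qed.

Lemma Drk1 k : Drk k 1 = 1.
Proof. by rewrite -[1]/(inD 1) Drk_inD rho1. Qed.

Lemma DrkD k a b : Drk k (a + b) = Drk k a + Drk k b.
Proof.
apply: D_eq; first exact: finc_eq.
by rewrite /Drk /Dk /= scalerDr; apply/incidenceP.
Qed.

Lemma Drk_snd k a : (Drk k a).2 = k *: rhoi a.2.
Proof. exact/incidenceP. Qed.

Lemma Drk_fst k a : (Drk k a).1 = rho a.1.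
Proof. by []. Qed.

Lemma DrkK k : k * k = 1 -> involutive (Drk k).
Proof.
move=> kk a; apply: D_eq; first exact: rhoK.
rewrite Drk_snd; apply/incidenceP => x y.
by rewrite incZ /= !(lamK lamP) mulrA kk mul1r.
Qed.

Lemma Drho_epsE (eps : fixed_point lam -> Kstar K) a :
  Drho_eps lamP eps a = inD (u_eps eps) * Drho lamP a * inD (u_eps_inv eps).
Proof.
apply: D_eq; first by rewrite !DfstM.
by rewrite !DsndM !DfstM convf0 conv0f add0r addr0.
Qed.

Lemma u_epsDK (eps : fixed_point lam -> Kstar K) :
  inD (u_eps eps) * inD (u_eps_inv eps) = 1 :> Dalg X K.
Proof. exact/inDK/u_epsK. Qed.

Lemma u_epsDVK (eps : fixed_point lam -> Kstar K) :
  inD (u_eps_inv eps) * inD (u_eps eps) = 1 :> Dalg X K.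
Proof. exact/inDK/u_epsVK. Qed.

Lemma u_eps_fix (eps : fixed_point lam -> Kstar K) (z : fixed_point lam) :
  u_eps eps (val z) (val z) = val (eps z).
Proof. by rewrite /= eqxx valK. Qed.

Lemma insub_lam (T : Type) (F : fixed_point lam -> T) (t : T) x :
  (if insub (lam x) is Some z then F z else t) =
  (if insub x is Some z then F z else t).
Proof.
have [->//|lx] := eqVneq (lam x) x.
have llx : lam (lam x) != lam x by rewrite (lamK lamP) eq_sym.
by rewrite !insubN.
Qed.

Lemma rho_u_eps_inv (eps : fixed_point lam -> Kstar K) :
  rho (u_eps_inv eps) = u_eps_inv eps.
Proof.
rewrite /u_eps_inv rho_diag; congr diag; apply/funext => x.
exact: (insub_lam (fun w => (val (eps w))^-1)).
Qed.

(** The multiples of [(0, delta)] are fixed by inner automorphisms, so that an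
    involution multiplies [(0, delta)] by its sign. *)
Lemma inN1_conj U V k : U * V = 1 ->
  U * inN (k *: (1 : finc X K)) * V = inN (k *: (1 : finc X K)).
Proof.
move=> UV; apply: D_eq; first by rewrite !DfstM mulr0 mul0r.
rewrite !DsndM DfstM mulr0 conv0f add0r [conv U.2 _]convf0 addr0.
by rewrite conv_1sc [LHS]convZl -[conv _ _]/(finc_inc (U.1 * V.1)) -DfstM UV.
Qed.

Lemma Phi_inN1 Phi U V k : U * V = 1 -> (forall a, Phi a = U * Drk k a * V) ->
  Phi (inN (1 : finc X K)) = inN (k *: (1 : finc X K)).
Proof.
move=> UV ->; rewrite (_ : Drk k _ = inN (k *: (1 : finc X K))) ?inN1_conj //.
apply: D_eq; first exact: rho0.
by rewrite Drk_snd -[rhoi _]/(finc_inc (rho 1)) rho1.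
Qed.

Lemma inN_scalar_inj (x0 : X) k k' :
  inN (k *: (1 : finc X K)) = inN (k' *: (1 : finc X K)) -> k = k'.
Proof.
move=> /(congr1 snd)/(congr1 (fun i : incidence X K => i x0 x0)) /=.
by rewrite eqxx !mulr1.
Qed.

Hypothesis X_conn : poset_connected X.
Hypothesis mult_inner : forall s : incidence X K, multiplicative s ->
  inner_automorphism (mult_aut s).
Hypothesis der_inner : forall Der : finc X K -> incidence X K,
  derivation Der -> inner_derivation Der.
Variable x0 : X.

(** Every involution inducing [lam] is [Psi \o Drk k] with [Psi] inner, since
    its composition with [Drho] is a class-preserving automorphism. *)
Lemma involution_form Phi : Dinvolution Phi -> induces Phi lam ->
  exists U V k, [/\ U * V = 1, V * U = 1, k * k = 1
    & forall a, Phi a = U * Drk k a * V].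
Proof.
move=> [Phi_lin PhiM PhiK] Phi_lam.
have [||a|U [V [k [UV VU thE]]]] := @cp_structure _ _ _ _ lamP X_conn mult_inner
    der_inner x0 (fun a => Phi (Drho lamP a)) (fun a => Drho lamP (Phi a)).
- split=> [c a b|a b|x]; first by rewrite Drho_lin Phi_lin.
    by rewrite DrhoM PhiM.
  by rewrite Drho_inD rho_e -{2}(lamK lamP x); exact: Phi_lam.
- split=> [c a b|a b|x]; first by rewrite Phi_lin Drho_lin.
    by rewrite PhiM DrhoM.
  have [u [v [uv vu e_uv]]] := Phi_lam x.
  have Drho1 : Drho lamP 1 = 1 :> Dalg X K by rewrite -[1]/(inD 1) Drho_inD rho1.
  exists (Drho lamP v), (Drho lamP u); split; rewrite -?DrhoM ?uv ?vu //.
  by rewrite mulrA -e_uv -[(_, 0)]/(inD _) Drho_inD rho_e (lamK lamP).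
- by rewrite PhiK DrhoK.
have PhiE a : Phi a = U * Drk k a * V.
  rewrite -{1}(DrhoK a) thE; congr (_ * _ * _).
  by apply: D_eq; rewrite // Drk_snd.
exists U, V, k; split=> //; apply: (inN_scalar_inj x0).
rewrite -scalerA.
have := PhiK (inN (1 : finc X K)); rewrite (Phi_inN1 UV PhiE).
rewrite (_ : inN (k *: _) = k *: inN (1 : finc X K)); last exact: (linZ inN_lin).
rewrite (linZ Phi_lin) (Phi_inN1 UV PhiE) => kk.
by rewrite [LHS](linZ inN_lin) kk scale1r.
Qed.

(** When [2] is invertible and [lam] has a fixed point, the conjugating unit
    can be taken invariant under [Drk k]: replace [U] by [U + Drk k U], which
    is a central multiple of [U] whose scalar part is [2]. *)
Lemma involution_symmetric Phi : (2%:R : K) != 0 -> lam x0 = x0 ->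
    Dinvolution Phi -> induces Phi lam ->
  exists U V k, [/\ U * V = 1, V * U = 1, k * k = 1, Drk k U = U
    & forall a, Phi a = U * Drk k a * V].
Proof.
move=> two_neq0 lx0 Phi_inv Phi_lam; have [_ _ PhiK] := Phi_inv.
have [U [V [k [UV VU kk PhiE]]]] := involution_form Phi_inv Phi_lam.
have RK := DrkK kk.
have [T [TC RU]] := involution_twist (DrkM k) (Drk1 k) VU PhiE RK PhiK.
pose t := T.1 x0 x0.
have T1 : T.1 = t *: (1 : finc X K).
  by apply: finc_center => // f; rewrite -[f]/((inD f).1) -!DfstM TC.
(* The diagonal value of [R U] at the fixed point [x0] is that of [U]. *)
have t1 : t = 1.
  have U0 : U.1 x0 x0 != 0 by apply: (@unit_diag _ _ _ _ V.1); rewrite -DfstM UV.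
  have := finc_at x0 x0 (congr1 fst RU); rewrite Drk_fst DfstM finc_mulxx T1.
  rewrite fincZ finc1xx mulr1 -[rho _ _ _]/(U.1 (lam x0) (lam x0)) lx0 => /eqP.
  by rewrite -{1}[U.1 x0 x0]mul1r (inj_eq (mulIf U0)) => /eqP <-.
have [Z' [ZZ Z'Z]] := D_scalar_unit T.2 two_neq0.
set Z : Dalg X K := (_, _) in ZZ Z'Z.
have ZE : Z = 1 + T.
  apply: D_eq; last by rewrite [RHS]add0r.
  rewrite [RHS](_ : _ = 1 + T.1) // T1 t1 scale1r.
  exact: (scaler_nat 2 (1 : finc X K)).
have ZC a : Z * a = a * Z by rewrite ZE mulrDl mulrDr mul1r mulr1 TC.
have ZU : Z * U = U + Drk k U by rewrite ZE mulrDl mul1r RU.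
exists (Z * U), (V * Z'), k; split=> //.
- by rewrite mulrA -(mulrA Z) UV mulr1.
- by rewrite mulrA -(mulrA V) Z'Z mulr1.
- by rewrite ZU DrkD RK addrC.
- by move=> a; rewrite PhiE !mulrA -!(mulrA Z) ZC -[RHS]mulrA -ZC ZZ mulr1.
Qed.

End Involutions.

(** * Square roots in finitary incidence algebras *)

(** Polynomials that approximate the inverse square root of [1 + 'X] to every
    order, compatibly. *)
Lemma inv_sqrt_poly (K : fieldType) : (2%:R : K) != 0 ->
  exists s : nat -> {poly K}, forall n,
    'X^(n.+1) %| 1 - s n ^+ 2 * (1 + 'X) /\ 'X^(n.+1) %| s n.+1 - s n.
Proof.
move=> two_neq0; pose c : {poly K} := (2%:R^-1)%:P.
have c2 : 2%:R * c = 1.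
  by rewrite /c -polyC_natr -polyCM mulfV.
pose r (p : {poly K}) := 1 - p ^+ 2 * (1 + 'X).
(* Newton's iteration, where [c] is one half. *)
pose s := fix s n := if n is n'.+1 then s n' + c * s n' * r (s n') else 1.
have rS n : r (s n.+1) = r (s n) ^+ 2 * (1 - c ^+ 2 + c ^+ 2 * r (s n)).
  rewrite /=; set p := s n; rewrite /r.
  have -> : forall t, 1 - (p + c * p * (1 - p ^+ 2 * (1 + t))) ^+ 2 * (1 + t) =
    (1 - p ^+ 2 * (1 + t)) ^+ 2 * (1 - c ^+ 2 + c ^+ 2 * (1 - p ^+ 2 * (1 + t)))
    + (1 - 2%:R * c) * (1 - p ^+ 2 * (1 + t)) * (p ^+ 2 * (1 + t)).
    by move=> t; ring.
  by rewrite c2 subrr !mul0r addr0.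
have rX n : 'X^(n.+1) %| r (s n).
  elim: n => [|n IHn].
    by rewrite /r /= expr1n mul1r opprD addrA subrr add0r dvdpNr expr1.
  rewrite rS dvdp_mulr //.
  rewrite (dvdp_trans (dvdp_exp2l _ _ : 'X^(n.+2) %| 'X^(n.+1 * 2))) //.
    by rewrite muln2 -addnn addSnnS leq_addl.
  by rewrite exprM dvdp_exp2r.
exists s => n; split; first exact: rX.
by rewrite /= addrC addKr dvdp_mull.
Qed.

(** [FI(X, K)] as an algebra over [K]. The point [x0] makes the ring nonzero,
    which polynomial evaluation in an algebra requires. *)
Definition finc_alg {disp : Order.disp_t} {X : porderType disp} (K : fieldType)
  (x0 : X) : Type := finc X K.

Section FincAlgebra.
Context {disp : Order.disp_t} {X : porderType disp} {K : fieldType} (x0 : X).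
Local Notation A := (finc_alg K x0).
HB.instance Definition _ := GRing.PzRing.on A.
HB.instance Definition _ := GRing.Lmodule.on A.

Fact finc_oner_neq0 : (1 : A) != 0.
Proof.
by apply/eqP => /(finc_at x0 x0); rewrite finc1xx => /eqP; rewrite oner_eq0.
Qed.
HB.instance Definition _ := GRing.PzSemiRing_isNonZero.Build A finc_oner_neq0.
HB.instance Definition _ :=
  GRing.LSemiModule_isLSemiAlgebra.Build K A (@finc_scaleAl _ X K).
HB.instance Definition _ :=
  GRing.LSemiAlgebra_isSemiAlgebra.Build K A (@finc_scaleAr _ X K).
End FincAlgebra.

Section Local.
Context {disp : Order.disp_t} {X : porderType disp} {K : fieldType}.
Implicit Types (f g m : finc X K) (x y z a b : X).

(** Agreement of two functions on all the subintervals of [[x, y]]. *)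
Definition eq_on x y f g :=
  forall a b, (x <= a)%O -> (b <= y)%O -> f a b = g a b.

Lemma eq_onM x y f f' g g' :
  eq_on x y f f' -> eq_on x y g g' -> eq_on x y (f * g) (f' * g').
Proof.
move=> ff gg a b xa yb; rewrite !finc_mulE; apply: eq_fsbigr => z.
rewrite inE => /andP[az zb].
by rewrite (ff _ _ xa (le_trans zb yb)) (gg _ _ (le_trans xa az) yb).
Qed.

Lemma eq_on_refl x y f : eq_on x y f f. Proof. by []. Qed.

(** A sequence of finitary functions that is stationary on every interval has a
    finitary limit. *)
Lemma finc_glue (F : nat -> finc X K) (N : X -> X -> nat) :
    (forall x y n, (N x y <= n)%N -> eq_on x y (F n) (F (N x y))) ->
  exists S : finc X K, forall x y n, (N x y <= n)%N -> eq_on x y S (F n).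
Proof.
move=> FN.
have S_sub : incidence_pred (fun x y => F (N x y) x y).
  by apply/asboolP => x y; exact: incidence0.
have SE x y n : (N x y <= n)%N -> forall a b, (x <= a)%O -> (b <= y)%O ->
    Incidence S_sub a b = F n a b.
  move=> Nn a b xa yb /=; pose M := maxn n (N a b).
  rewrite -(FN a b M (leq_maxr _ _)) // (FN x y M) //.
    by rewrite -(FN x y n).
  by rewrite (leq_trans Nn) ?leq_maxl.
have S_fin : finc_pred (Incidence S_sub).
  apply/asboolP => x y xy; apply: sub_finite_set (fincP (F (N x y)) xy) => p.
  by move=> /= [xp pp py nz]; split=> //; rewrite -(SE x y).
by exists (Finc S_fin) => x y n Nn a b xa yb; exact: (SE x y).
Qed.

(** A function with zero diagonal is locally nilpotent: a nonzero value of
    [m ^+ n] in [[x, y]] comes from a chain of [n] points at which nonzero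
    values of [m] start, and these points are finite in number. *)
Lemma locally_nilpotent m : (forall x, m x x = 0) ->
  forall x y, exists N, forall n, (N <= n)%N -> eq_on x y (m ^+ n) 0.
Proof.
move=> m0 x y; have [xy|nxy] := boolP (x <= y)%O; last first.
  exists 0 => n _ a b xa yb; rewrite finc0 incidence0 //.
  by apply: contra nxy => ab; apply: le_trans xa (le_trans ab yb).
have /(finite_image fst)/finite_seqP[F FE] := fincP m xy.
have chain n a b : (x <= a)%O -> (b <= y)%O -> (m ^+ n) a b != 0 ->
    exists s, [/\ size s = n, sorted <%O s, all (>= a)%O s & {subset s <= F}].
  elim: n a => [|n IHn] a xa yb; first by exists [::].
  rewrite exprS finc_mulE => /conv_neq0[z /andP[az zb]].
  rewrite mulf_eq0 negb_or => /andP[maz mzb].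
  have {}az : (a < z)%O.
    by rewrite lt_neqAle az andbT; apply: contraNneq maz => ->; rewrite m0.
  have [s [sn s_sort za sF]] := IHn z (le_trans xa (ltW az)) yb mzb.
  exists (a :: s); split=> /=; first by rewrite sn.
  - rewrite path_sortedE ?s_sort ?andbT; last exact: lt_trans.
    by apply: sub_all za => w; exact: lt_le_trans.
  - by rewrite lexx; apply: sub_all za => w; apply: le_trans (ltW az).
  - move=> w; rewrite inE => /predU1P[->|/sF//].
    have : (fst @` [set p : X * X | [/\ (x <= p.1)%O, (p.1 < p.2)%O, (p.2 <= y)%O
                                  & m p.1 p.2 != 0]]) a.
      by exists (a, z) => //; split=> //=; apply: le_trans zb yb.
    by rewrite FE.
exists (size F).+1 => n nF a b xa yb; apply: contraTeq nF => /(chain _ _ _ xa yb).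
move=> [s [<- s_sort _ sF]]; rewrite -leqNgt; apply: uniq_leq_size => //.
exact: lt_sorted_uniq.
Qed.

Section InvSqrt.
Variable x0 : X.

(** Evaluation of a polynomial at an element of [FI(X, K)]. *)
Definition ev m (p : {poly K}) : finc X K := horner_alg (m : finc_alg K x0) p.

Lemma ev_at_X m : ev m 'X = m.
Proof. exact: (@horner_algX K (finc_alg K x0) m). Qed.
Lemma evC m c : ev m c%:P = c *: (1 : finc X K).
Proof. exact: (@horner_algC K (finc_alg K x0) m). Qed.
Lemma ev0 m : ev m 0 = 0.
Proof. exact: (rmorph0 (horner_alg (m : finc_alg K x0))). Qed.
Lemma ev1 m : ev m 1 = 1.
Proof. exact: (rmorph1 (horner_alg (m : finc_alg K x0))). Qed.
Lemma evD m p q : ev m (p + q) = ev m p + ev m q.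
Proof. exact: (rmorphD (horner_alg (m : finc_alg K x0))). Qed.
Lemma evB m p q : ev m (p - q) = ev m p - ev m q.
Proof. exact: (rmorphB (horner_alg (m : finc_alg K x0))). Qed.
Lemma evM m p q : ev m (p * q) = ev m p * ev m q.
Proof. exact: (rmorphM (horner_alg (m : finc_alg K x0))). Qed.

Lemma evXn m n : ev m 'X^n = m ^+ n.
Proof.
by elim: n => [|n IHn]; rewrite ?expr0 ?ev1 // !exprS evM IHn ev_at_X.
Qed.

Lemma ev_comm m p : ev m p * m = m * ev m p.
Proof. by have := evM m p 'X; rewrite mulrC evM ev_at_X. Qed.

Lemma ev_anti m (R : finc X K -> finc X K) E E' p :
    (forall f g, R (f * g) = R g * R f) -> linear R -> R 1 = 1 ->
    E * E' = 1 -> E' * E = 1 -> R m = E * m * E' ->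
  R (ev m p) = E * ev m p * E'.
Proof.
move=> RM R_lin R1 EE E'E Rm.
elim/poly_ind: p => [|p c IHp].
  by rewrite ev0 (lin0 R_lin) mulr0 mul0r.
rewrite evD evM ev_at_X evC.
rewrite (linD R_lin) RM IHp Rm (linZ R_lin) R1 mulrDr mulrDl; congr (_ + _).
  by rewrite ev_comm !mulrA -(mulrA _ E' E) E'E mulr1.
by rewrite -finc_scaleAr -finc_scaleAl mulr1 EE.
Qed.

(** If [m] has zero diagonal then [1 + m] has an inverse square root [S], which
    is locally a polynomial in [m]; in particular [S] commutes with [m] and
    inherits the twisted symmetries of [m]. *)
Lemma finc_inv_sqrt m : (2%:R : K) != 0 -> (forall x, m x x = 0) ->
  exists S, [/\ S * S * (1 + m) = 1, S * m = m * S
   & forall lam (lamP : poset_involution lam) E E', E * E' = 1 -> E' * E = 1 ->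
      rho lamP m = E * m * E' -> rho lamP S = E * S * E'].
Proof.
move=> two_neq0 m0; have [s sP] := inv_sqrt_poly two_neq0.
have /choice[N0 N0P] (p : X * X) : exists N, forall n, (N <= n)%N ->
  eq_on p.1 p.2 (m ^+ n) 0 by exact: locally_nilpotent.
pose N x y := N0 (x, y).
have ev_small x y n p : (N x y <= n)%N -> 'X^(n.+1) %| p -> eq_on x y (ev m p) 0.
  move=> Nn /dvdpP[q ->]; rewrite evM evXn => a b xa yb.
  rewrite (eq_onM (@eq_on_refl x y _) (N0P (x, y) _ _)) ?mulr0 //.
  exact: leq_trans Nn (leqnSn n).
have [|S SP] := finc_glue (F := fun n => ev m (s n)) (N := N).
  move=> x y n /subnK <-; elim: (n - N x y)%N => [//|k IHk] a b xa yb.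
  rewrite -IHk // addSn; apply/eqP; rewrite -subr_eq0 -fincN -fincDE -evB.
  by rewrite (ev_small x y (k + N x y)%N) ?leq_addl //; exact: (sP _).2.
have SPx x y n : (N x y <= n)%N -> eq_on x y (ev m (s n)) S.
  by move=> Nn a b xa yb; rewrite -(SP x y n).
have SS x y : eq_on x y S (ev m (s (N x y))) by exact: SP.
exists S; split.
- apply: finc_eq => x y.
  have [xy|nxy] := boolP (x <= y)%O; last by rewrite !incidence0.
  rewrite (eq_onM (eq_onM (SS x y) (SS x y)) (@eq_on_refl x y _)) //.
  have -> : ev m (s (N x y)) * ev m (s (N x y)) * (1 + m) =
    1 - ev m (1 - s (N x y) ^+ 2 * (1 + 'X)).
    by rewrite evB ev1 evM expr2 evM evD ev1 ev_at_X subKr.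
  by rewrite fincDE fincN (ev_small x y _ _ (leqnn _) (sP _).1) // subr0.
- apply: finc_eq => x y.
  have [xy|nxy] := boolP (x <= y)%O; last by rewrite !incidence0.
  rewrite (eq_onM (SS x y) (@eq_on_refl x y m)) // ev_comm.
  by rewrite -(eq_onM (@eq_on_refl x y m) (SS x y)).
- move=> lam lamP E E' EE E'E rm.
  apply: finc_eq => x y.
  have [xy|nxy] := boolP (x <= y)%O; last by rewrite !incidence0.
  pose n := maxn (N x y) (N (lam y) (lam x)).
  have -> : rho lamP S x y = rho lamP (ev m (s n)) x y.
    by rewrite /= (SP (lam y) (lam x) n) ?leq_maxr.
  rewrite (ev_anti (E := E) (E' := E')) //; first last.
  - exact: rho1.
  - by move=> c f g; exact: finc_eq.
  - exact: rhoM.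
  have SPn := SPx x y n (leq_maxl _ _).
  by rewrite (eq_onM (eq_onM (@eq_on_refl x y E) SPn) (@eq_on_refl x y E')).
Qed.

End InvSqrt.
End Local.

(** * Normal forms and their classification *)

Section Classification.
Context {disp : Order.disp_t} {X : porderType disp} {K : fieldType}.
Variables (lam : X -> X) (lamP : poset_involution lam).
Implicit Types (f g u v : finc X K) (i j : incidence X K) (x y : X).
Implicit Types (a b U V : Dalg X K) (k : K) (Phi : Dalg X K -> Dalg X K).
Implicit Types (eps : fixed_point lam -> Kstar K).

Local Notation rho := (rho lamP (K := K)).
Local Notation rhoi := (rho_inc lamP (K := K)).
Local Notation R := (Drk lamP).

(** Choosing one point in each two-point orbit of [lam] solves
    [t x * t (lam x) = c x] off the fixed points, at which [t] can be prescribed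
    freely. *)
Lemma orbit_factorization (c a : X -> K) :
    (forall x, c x != 0) -> (forall x, c (lam x) = c x) -> (forall x, a x != 0) ->
  exists t : X -> K, [/\ forall x, t x != 0, forall x, lam x = x -> t x = a x
    & forall x, lam x != x -> t x * t (lam x) = c x].
Proof.
move=> c0 clam a0.
pose orb x := [pred y | (y == x) || (y == lam x)].
pose r x := choose (orb x) x.
have r_lam x : r (lam x) = r x.
  have orbE : orb (lam x) =1 orb x by move=> y; rewrite /= (lamK lamP) orbC.
  by rewrite /r (eq_choose orbE); apply: choose_id; rewrite /= eqxx ?orbT.
have r_orb x : r x = x \/ r x = lam x.
  have : orb x (r x) by apply: chooseP; rewrite /= eqxx.
  by move=> /orP[/eqP|/eqP]; [left|right].
pose t x := if lam x == x then a x else if r x == x then 1 else c x.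
exists t; split=> [x|x lx|x lx]; rewrite /t.
- by case: ifP => // _; case: ifP; rewrite ?oner_eq0.
- by rewrite lx eqxx.
- have llx : lam x == x = false by apply/negbTE.
  have xlx : x == lam x = false by rewrite eq_sym.
  rewrite (lamK lamP) llx xlx r_lam clam.
  by have [->|->] := r_orb x; rewrite eqxx ?llx ?xlx ?mul1r ?mulr1.
Qed.

Lemma diag_unit (t : X -> K) : (forall x, t x != 0) ->
  diag t * diag (fun x => (t x)^-1) = 1 /\ diag (fun x => (t x)^-1) * diag t = 1.
Proof.
by move=> t0; split; rewrite diagM; apply: diag1 => x; rewrite ?mulfV ?mulVf.
Qed.

(** A symmetric unit [u] of [FI(X, K)] is congruent to some [u_eps]. After a
    diagonal congruence, [u = u_eps * (1 + m)] with [m] of zero diagonal, and the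
    inverse square root of [1 + m] does the rest. *)
Lemma symmetric_congruence (x0 : X) u v : (2%:R : K) != 0 ->
    u * v = 1 -> rho u = u ->
  exists eps w w', [/\ w * w' = 1, w' * w = 1 & w * u * rho w = u_eps eps].
Proof.
move=> two_neq0 uv ru.
have d0 x : u x x != 0 := unit_diag x uv.
have dlam x : u (lam x) (lam x) = u x x by rewrite -[in RHS]ru.
have [x|x|x|t [t0 t_fix t_nonfix]] :=
    @orbit_factorization (fun x => (u x x)^-1) (fun=> 1).
- by rewrite invr_eq0.
- by rewrite dlam.
- exact: oner_neq0.
pose eps (z : fixed_point lam) : Kstar K :=
  exist (fun c : K => c != 0) (u (val z) (val z)) (d0 (val z)).
pose E : finc X K := u_eps eps; pose E' : finc X K := u_eps_inv eps.
have EE : E * E' = 1 by exact: u_epsK.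
have E'E : E' * E = 1 by exact: u_epsVK.
pose u1 := diag t * u * rho (diag t).
have ru1 : rho u1 = u1 by rewrite /u1 !rhoM (rhoK lamP) ru mulrA.
have u1_diag x : u1 x x = E x x.
  rewrite /u1 !finc_mulxx rho_diag /= !eqxx.
  have [lx|lx] := eqVneq (lam x) x.
    rewrite lx t_fix // mul1r mulr1.
    by rewrite insubT ?lx // => ?; rewrite /=.
  by rewrite insubN // mulrAC t_nonfix // mulVf.
pose m := E' * u1 - 1.
have m1 : 1 + m = E' * u1 by rewrite /m addrC subrK.
have m0 x : m x x = 0.
  rewrite /m fincDE fincN finc1xx finc_mulxx u1_diag -finc_mulxx E'E.
  by rewrite finc1xx subrr.
have rm : rho m = E * m * E'.
  have rhoB f g : rho (f - g) = rho f - rho g by exact: finc_eq.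
  rewrite /m rhoB rhoM ru1 rho1 (rho_u_eps_inv lamP) mulrBr mulrBl mulr1 EE.
  by rewrite !mulrA EE mul1r.
have [S [SS Sm S_anti]] := finc_inv_sqrt x0 two_neq0 m0.
have SM : S * (1 + m) = (1 + m) * S by rewrite mulrDr mulrDl mulr1 mul1r Sm.
have rS := S_anti lam lamP E E' EE E'E rm.
have [tt' t't] := diag_unit t0.
have S1 : S * (S * (1 + m)) = 1 by rewrite mulrA.
have S2 : S * (1 + m) * S = 1 by rewrite -mulrA -SM.
exists eps, (rho S * diag t), (diag (fun x => (t x)^-1) * rho (S * (1 + m))).
split.
- by rewrite mulrA -(mulrA (rho S)) tt' mulr1 -rhoM S2 rho1.
- by rewrite mulrA -(mulrA _ _ (rho S)) -rhoM S1 rho1 mulr1.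
- rewrite rhoM (rhoK lamP).
  have -> : rho S * diag t * u * (rho (diag t) * S) = rho S * u1 * S.
    by rewrite /u1 !mulrA.
  by rewrite rS -(mulrA (E * S) E') -m1 -(mulrA E S) -(mulrA E) S2 mulr1.
Qed.

Section NormalForm.
Hypothesis X_conn : poset_connected X.
Hypothesis mult_inner : forall s : incidence X K, multiplicative s ->
  inner_automorphism (mult_aut s).
Hypothesis der_inner : forall Der : finc X K -> incidence X K,
  derivation Der -> inner_derivation Der.
Hypothesis two_neq0 : (2%:R : K) != 0.
Variable x0 : X.
Hypothesis lx0 : lam x0 = x0.

Lemma Drho_eps_DkE eps k a :
  (Drho_eps lamP eps \o Dk k) a = inD (u_eps eps) * R k a * inD (u_eps_inv eps).
Proof. by rewrite /= Drho_epsE. Qed.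

(** Every involution inducing [lam] is equivalent to a normal form. *)
Lemma involution_normal_form Phi : Dinvolution Phi -> induces Phi lam ->
  exists U V k eps, [/\ U * V = 1, V * U = 1, k * k = 1,
    forall a, Phi a = U * R k a * V
    & inner_equivalent Phi (Drho_eps lamP eps \o Dk k)].
Proof.
move=> Phi_inv Phi_lam.
have [U [V [k [UV VU kk RU PhiE]]]] := involution_symmetric lamP X_conn
  mult_inner der_inner two_neq0 lx0 Phi_inv Phi_lam.
have u_sym : rho U.1 = U.1 by rewrite -{2}RU.
have [eps [w [w' [ww w'w wuw]]]] :=
  @symmetric_congruence x0 U.1 V.1 two_neq0 (congr1 fst UV) u_sym.
exists U, V, k, eps; split=> //.
pose U1 := inD w * U * R k (inD w).
have RU1 : R k U1 = U1.
  by rewrite /U1 !DrkM (DrkK lamP kk) RU mulrA.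
have U1_fst : U1.1 = u_eps eps by rewrite -wuw /U1 Drk_inD.
have RU1_snd : k *: rhoi U1.2 = U1.2 by rewrite -Drk_snd RU1.
(* [(1, h)] kills the second component of [U1]. *)
pose h := - 2%:R^-1 *: conv U1.2 (u_eps_inv eps).
pose N : Dalg X K := (1, h); pose N' : Dalg X K := (1, - h).
have NN' : N * N' = 1.
  by apply: D_eq; rewrite ?DfstM ?mulr1 // DsndM conv1f convf1 addNr.
have N'N : N' * N = 1.
  by apply: D_eq; rewrite ?DfstM ?mulr1 // DsndM conv1f convf1 subrr.
have Rh : k *: rhoi h = - 2%:R^-1 *: conv (u_eps_inv eps) U1.2.
  have rhoiZ c i : rhoi (c *: i) = c *: rhoi i by exact/incidenceP.
  rewrite /h rhoiZ rho_inc_conv scalerA mulrC -scalerA -convZr RU1_snd.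
  have re : rhoi (u_eps_inv eps) = u_eps_inv eps.
    exact: (congr1 val (rho_u_eps_inv lamP eps)).
  by rewrite re.
have U1E : inD w * U * R k (inD w) = U1 by [].
clearbody U1.
have ueK i : conv (u_eps eps) (conv (u_eps_inv eps) i) = i.
  rewrite -convA_ffi.
  rewrite -[conv _ (u_eps_inv eps)]/(finc_inc (u_eps eps * u_eps_inv eps)).
  by rewrite u_epsK conv1f.
have Kue i : conv (conv i (u_eps_inv eps)) (u_eps eps) = i.
  rewrite convA_iff.
  rewrite -[conv _ (u_eps eps)]/(finc_inc (u_eps_inv eps * u_eps eps)).
  by rewrite u_epsVK convf1.
have NU1 : N * U1 * R k N = inD (u_eps eps).
  have RN1 : (R k N).1 = 1 by rewrite Drk_fst rho1.
  have RN2 : (R k N).2 = k *: rhoi h by rewrite Drk_snd.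
  apply: D_eq; first by rewrite !DfstM RN1 U1_fst mul1r mulr1.
  rewrite DsndM RN1 RN2 Rh DfstM mul1r U1_fst convf1 DsndM conv1f U1_fst.
  rewrite convZr ueK convZl Kue.
  have half : 1 - 2%:R^-1 - 2%:R^-1 = 0 :> K by field.
  by rewrite -{2}[U1.2]scale1r -!scalerDl addrCA addrA half scale0r.
apply: (congruence_equivalent (DrkM lamP k) (Drk1 lamP k) VU
  (u_epsDK eps) PhiE (Drho_eps_DkE eps k)
  (W := N * inD w) (W' := inD w' * N') (Z := 1) (Z' := 1)).
- by rewrite mulrA -(mulrA N) inDK // mulr1.
- by rewrite mulrA -(mulrA _ N') N'N mulr1 inDK.
- by rewrite mulr1.
- by move=> a; rewrite mul1r mulr1.
- by rewrite DrkM mul1r -NU1 -U1E !mulrA.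
Qed.

(** Normal forms with the same sign are equivalent when the square classes of
    their parameters agree up to a constant. *)
Lemma eps_equivalent k eps eps' (g : sqr_class K) :
    (forall z, chi eps z = (g * chi eps' z)%g) ->
  inner_equivalent (Drho_eps lamP eps \o Dk k) (Drho_eps lamP eps' \o Dk k).
Proof.
elim/sqr_class_ind: g => c chi_g.
have /choice[d dP] z : exists d : Kstar K, eps z = (c * eps' z * (d * d))%g.
  by apply/sqr_projP; rewrite sqr_projM; exact: chi_g.
pose a x : K := if insub x is Some z then (val (d z : Kstar K))^-1 else 1.
have [x|//|x|t [t0 t_fix t_nonfix]] := @orbit_factorization (fun=> val c) a.
- exact: (valP c).
- rewrite /a; case: insubP => [z _ _|_]; rewrite ?oner_eq0 //.
  by rewrite invr_eq0 (valP (d z)).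
have [tt t't] := diag_unit t0.
apply: (congruence_equivalent (DrkM lamP k) (Drk1 lamP k)
  (u_epsDVK eps) (u_epsDK eps')
  (Drho_eps_DkE eps k) (Drho_eps_DkE eps' k)
  (W := inD (diag t)) (W' := inD (diag (fun x => (t x)^-1)))
  (Z := inD (diag (fun=> val c))) (Z' := inD (diag (fun=> (val c)^-1)))).
- exact: inDK.
- exact: inDK.
- by apply/inDK; rewrite diagM; apply: diag1 => x; rewrite mulfV // (valP c).
- have dc : diag (fun=> val c) = val c *: (1 : finc X K).
    apply: finc_eq => x y; rewrite fincZ finc1E /=.
    by case: eqP; rewrite ?mulr1 ?mulr0.
  move=> b; rewrite dc (linZ inD_lin) (_ : inD 1 = 1) //.
  by rewrite -Dalg_scaleAl -Dalg_scaleAr mul1r mulr1.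
rewrite Drk_inD rho_diag -!inDM !diagM; congr (inD (diag _)); apply/funext => x /=.
case: insubP => [z lx zx|lx]; last by rewrite !mulr1 t_nonfix.
move/eqP in lx; rewrite lx t_fix // /a -zx valK (congr1 val (dP z)) /=.
have := valP (d z); set e := val (d z) => e0.
by field.
Qed.

(** Conversely the square classes of the parameters are determined, up to a
    constant, by the equivalence class. *)
Lemma equivalent_eps k eps eps' : k * k = 1 ->
    inner_equivalent (Drho_eps lamP eps \o Dk k) (Drho_eps lamP eps' \o Dk k) ->
  exists g : sqr_class K, forall z, chi eps z = (g * chi eps' z)%g.
Proof.
move=> kk equiv.
have [W [W' [Z [WW W'W ZC WUW]]]] := equivalent_congruence (DrkM lamP k)
  (Drk1 lamP k) (u_epsDVK eps) (u_epsDK eps') (u_epsDVK eps')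
  (Drho_eps_DkE eps k) (Drho_eps_DkE eps' k) (DrkK lamP kk) equiv.
pose w x := W.1 x x.
have w0 x : w x != 0.
  by apply: (@unit_diag _ _ _ _ W'.1); rewrite -DfstM WW.
have Z1 : Z.1 = Z.1 x0 x0 *: (1 : finc X K).
  apply: finc_center => // f; by rewrite -[f]/((inD f).1) -!DfstM ZC.
pose c := Z.1 x0 x0.
have key (z : fixed_point lam) : w (val z) ^+ 2 * val (eps z) = c * val (eps' z).
  have lz : lam (val z) = val z by exact/eqP/(valP z).
  have := finc_at (val z) (val z) (congr1 fst WUW).
  rewrite !DfstM Drk_fst !finc_mulxx Z1 fincZ finc1xx mulr1 !u_eps_fix => <-.
  by rewrite -[rho _ _ _]/(W.1 (lam (val z)) (lam (val z))) lz mulrAC.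
have c0 : c != 0.
  have z0 : lam x0 == x0 by apply/eqP.
  have := key (exist _ x0 z0); apply: contra_eq_neq => ->.
  by rewrite mul0r mulf_neq0 ?expf_neq0 // (valP (eps _)).
exists (sqr_proj (exist (fun c : K => c != 0) c c0)) => z.
rewrite /chi -sqr_projM; apply/sqr_projP.
have wV : (w (val z))^-1 != 0 by rewrite invr_eq0.
exists (exist (fun c : K => c != 0) _ wV); apply: val_inj => /=.
rewrite -key -[sval (eps z)]/(val (eps z)) -[sval z]/(val z); field; exact: w0.
Qed.

(** The sign of an involution is read off its value at [(0, delta)]. *)
Lemma sign_inN1 Phi (k : @signs K) : is_sign lamP Phi k ->
  Phi (inN (1 : finc X K)) = inN (val k *: (1 : finc X K)).
Proof.
move=> [[Psi [U [V [UV _ PsiE]]] PhiE] _].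
by apply: (@Phi_inN1 _ _ _ _ lamP Phi U V) => // a; rewrite PhiE /= PsiE.
Qed.

Lemma is_sign_form Phi U V k (k_sign : (k == 1) || (k == -1)) :
    U * V = 1 -> V * U = 1 -> (forall a, Phi a = U * R k a * V) ->
  is_sign lamP Phi (exist _ k k_sign).
Proof.
move=> UV VU PhiE; split=> [|k' [Psi [U' [V' [UV' _ PsiE]]] PhiE']].
  exists (fun a => U * a * V); first by exists U, V.
  by move=> a; rewrite PhiE.
apply: val_inj; apply: (inN_scalar_inj x0); rewrite /= -(Phi_inN1 UV PhiE).
by apply: (@Phi_inN1 _ _ _ _ lamP Phi U' V') => // a; rewrite PhiE' /= PsiE.
Qed.

Lemma sign_sqr (k : @signs K) : val k * val k = 1.
Proof. by case: k => k /= /orP[]/eqP->; rewrite ?mulrNN mulr1. Qed.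

Lemma sqr_sign k : k * k = 1 -> (k == 1) || (k == -1).
Proof. by move=> kk; rewrite -sqrf_eq1 expr2 kk. Qed.

Lemma inner_equivalent_sign Phi1 Phi2 (k : @signs K) :
    Dinvolution Phi2 -> induces Phi2 lam -> inner_equivalent Phi1 Phi2 ->
  is_sign lamP Phi1 k -> is_sign lamP Phi2 k.
Proof.
move=> Phi2_inv Phi2_lam [Psi [u [v [uv vu PsiE]]] eqPsi] sgn1.
have [U [V [k2 [UV VU kk PhiE]]]] := involution_form lamP X_conn mult_inner
  der_inner x0 Phi2_inv Phi2_lam.
have <- : exist _ k2 (sqr_sign kk) = k; last exact: (is_sign_form _ UV VU PhiE).
apply: val_inj; apply: (inN_scalar_inj x0); rewrite /= -(Phi_inN1 UV PhiE).
have := eqPsi (inN (1 : finc X K)); rewrite /= (sign_inN1 sgn1) !PsiE.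
have uv1 : u * inN (1 : finc X K) * v = inN (1 : finc X K).
  by have := inN1_conj 1 uv; rewrite scale1r.
by rewrite uv1 (inN1_conj _ uv) => ->.
Qed.

Lemma pair_equiv_sym (p q : (fixed_point lam -> sqr_class K) * @signs K) :
  pair_equiv p q -> pair_equiv q p.
Proof.
move=> [pq [g pg]]; split; first exact: esym.
exists (g^-1)%g => x.
by rewrite pg mulKg.
Qed.

Lemma pair_equiv_trans (p q r : (fixed_point lam -> sqr_class K) * @signs K) :
  pair_equiv p q -> pair_equiv q r -> pair_equiv p r.
Proof.
move=> [pq [g pg]] [qr [h qh]]; split; first by rewrite pq.
exists (g * h)%g => x.
by rewrite pg qh mulgA.
Qed.

Lemma pair_class_eq (p q : (fixed_point lam -> sqr_class K) * @signs K) :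
  pair_class p = pair_class q <-> pair_equiv p q.
Proof.
split=> [pq|pq].
  rewrite -[pair_equiv p q]/(pair_class q p) -pq; split=> //.
  by exists 1%g => x; rewrite mul1g.
apply/seteqP; split=> r /= rp; apply: pair_equiv_trans rp _ => //.
exact: pair_equiv_sym.
Qed.

Lemma induced_class_form Phi (k : @signs K) eps : is_sign lamP Phi k ->
    inner_equivalent Phi (Drho_eps lamP eps \o Dk (val k)) ->
  is_induced_class lamP Phi (pair_class (chi eps, k)).
Proof.
move=> sgn equiv; split=> [|C [k' [eps' [sgn' equiv' ->]]]]; first by exists k, eps.
have kk' : k = k' by apply: sgn.2 _ sgn'.1.
rewrite -kk' in equiv' *; apply/pair_class_eq; split=> //.
apply: (equivalent_eps (sign_sqr k)).
exact: inner_equivalent_trans (inner_equivalent_sym equiv) equiv'.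
Qed.

Lemma classification Phi1 Phi2 : Dinvolution Phi1 -> Dinvolution Phi2 ->
    induces Phi1 lam -> induces Phi2 lam ->
  inner_equivalent Phi1 Phi2 <->
  exists C, is_induced_class lamP Phi1 C /\ is_induced_class lamP Phi2 C.
Proof.
move=> Phi1_inv Phi2_inv Phi1_lam Phi2_lam; split=> [equiv|[C [[ex1 _] [ex2 _]]]].
  have [U [V [k [eps [UV VU kk PhiE equiv1]]]]] :=
    involution_normal_form Phi1_inv Phi1_lam.
  have sgn1 := is_sign_form (sqr_sign kk) UV VU PhiE.
  have sgn2 := inner_equivalent_sign Phi2_inv Phi2_lam equiv sgn1.
  exists (pair_class (chi eps, exist _ k (sqr_sign kk))); split.
    exact: induced_class_form.
  apply: induced_class_form sgn2 _.
  exact: inner_equivalent_trans (inner_equivalent_sym equiv) equiv1.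
have [k [eps [_ equiv1 CE]]] := ex1; have [k' [eps' [_ equiv2 CE']]] := ex2.
move: CE'; rewrite CE => /pair_class_eq[/= kk' [g eps_g]].
rewrite -kk' in equiv2; apply: (inner_equivalent_trans equiv1).
apply: inner_equivalent_trans (inner_equivalent_sym equiv2).
exact: (eps_equivalent _ eps_g).
Qed.

End NormalForm.
End Classification.

Theorem theorem6p17 (disp : Order.disp_t) (X : porderType disp) (K : fieldType)
    (charK : 2%N \notin [pchar K]%R)
    (X_connected : poset_connected X)
    (mult_inner : forall s : incidence X K, multiplicative s ->
       inner_automorphism (mult_aut s))
    (der_inner : forall Der : finc X K -> incidence X K,
       derivation Der -> inner_derivation Der)
    (lam : X -> X) (lamP : poset_involution lam)
    (lam_fixed : exists x : X, lam x = x)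
    (Phi1 Phi2 : Dalg X K -> Dalg X K)
    (Phi1_inv : Dinvolution Phi1) (Phi2_inv : Dinvolution Phi2)
    (Phi1_lam : induces Phi1 lam) (Phi2_lam : induces Phi2 lam) :
  inner_equivalent Phi1 Phi2 <->
  exists C, is_induced_class lamP Phi1 C /\ is_induced_class lamP Phi2 C.
Proof.
have two_neq0 : (2%:R : K)%R != 0%R.
  by apply: contraNneq charK => two0; rewrite inE /= two0 eqxx.
have [x0 lx0] := lam_fixed.
exact: (classification lamP X_connected mult_inner der_inner two_neq0 lx0).
Qed.
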